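(* Let $k\geqslant 2$ and $p>1$ be integers, let $\varepsilon>0$ be arbitrary, and let $q\geqslant 2$ be a (large) natural number such that $$\theta(q)=\frac{\ln\bigl(6(1+\ln q)\bigr)}{\ln q}<\frac{1}{k},$$ and such that $\gcd(q-1,p)=1$. Let $a\in\mathbb{Z}$ be arbitrary. Then there is a number $\lambda\in(0,1)$ depending only on $p$ and $q$ such that, as $x\to\infty$, $$\sum_{\substack{n\leqslant x\\ S(n)\equiv a \ (\mathrm{mod}\ p)}}\tau_k(n)=\frac{1}{p}\sum_{n\leqslant x}\tau_k(n)+O\!\left(x^{1-\frac{1}{k}+\theta(q)+\varepsilon}\right)+O\!\left(x^{\lambda+\varepsilon}\right).$$
   Context: For a natural number $n$ with base-$q$ expansion $n=c_0+c_1q+\dots+c_\nu q^\nu$, $0\leqslant c_i<q$, we write $S(n)=c_0+c_1+\dots+c_\nu$ for the sum of its base-$q$ digits. $\tau_k(n)$ denotes the number of solutions of $x_1x_2\cdots x_k=n$ in natural numbers $x_1,\dots,x_k$. The implied constants in the $O$-terms may depend on $k,p,q,\varepsilon$ but not on $x$. *)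

(* Defs.v *)
From HB Require Import structures.
From mathcomp Require Import all_boot all_order all_algebra.
From mathcomp Require Import all_classical all_reals all_analysis.

Set Implicit Arguments.
Unset Strict Implicit.
Unset Printing Implicit Defensive.

Import Order.TTheory GRing.Theory Num.Theory.

Local Open Scope ring_scope.

(* Base-q digit sum, for q >= 2: the i-th digit of n is (n %/ q ^ i) %% q, and
   it vanishes for i > n because then n < q ^ i. *)
Definition digit_sum (q n : nat) : nat :=
  (\sum_(i < n.+1) (n %/ q ^ i) %% q)%N.

(* Number of k-tuples of positive integers with product n; each factor of such
   a product is at most n, so ranging over 'I_n.+1 loses no solution. *)
Definition tau (k n : nat) : nat :=
  #|[set x : {ffun 'I_k -> 'I_n.+1} |
      [forall i, 0 < x i] && (\prod_i (x i : nat) == n)]|%N.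

Definition theta {R : realType} (q : nat) : R :=
  ln (6 * (1 + ln q%:R)) / ln q%:R.

(* For x >= 0, Num.truncn x is the integer part of x. *)
Definition sum_tau {R : realType} (k : nat) (x : R) : nat :=
  (\sum_(1 <= n < (Num.truncn x).+1) tau k n)%N.

Definition sum_tau_digit {R : realType} (k p q : nat) (a : int) (x : R) : nat :=
  (\sum_(1 <= n < (Num.truncn x).+1 |
      ((digit_sum q n)%:Z == a %[mod p%:Z])%Z) tau k n)%N.

(* Main.v *)
Require Import Defs.
From HB Require Import structures.
From mathcomp Require Import all_boot all_order all_algebra.
From mathcomp Require Import all_classical all_reals all_analysis.
From mathcomp Require Import complex zify ring lra.

Set Implicit Arguments.
Unset Strict Implicit.
Unset Printing Implicit Defensive.

Import Order.TTheory GRing.Theory Num.Theory.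
Local Open Scope ring_scope.
(** Detecting the residue of the digit sum by characters, one needs a power saving
in [sum_(n <= x) tau_k(n) e(b S(n) / p)] for [0 < b < p].  Since [theta q > 0], only
finitely many [k] satisfy [theta q < 1 / k], so [lambda] may be the largest of the
exponents obtained for these [k] and absorbs the first error term as well.

Let [P] be slightly smaller than [x^(1/k)].  The factorisations with all factors at
most [P] are negligible; in the others a factor exceeding [P] is summed first, which
leaves sums of [e(b S(n) / p)] over multiples of moduli [d <= x / P].  Expanding
[d | n] in additive characters, writing [h / d] in lowest terms [a / r] and cutting
the summation range along base-[q] digits, everything reduces to the products
[prod_(i < n) phi(q^i a / r + b / p)], where [phi s = |1 + e(s) + ... + e((q-1) s)|].
For [q^i <= r < q^(i+1)] the fractions [a / r] lie in distinct cells of length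
[q^-(2i+2)], and the sum over all cells of a majorant of the product factors digit by
digit, each digit contributing at most [6 q (1 + ln q) = q^(1 + theta q)].  The
remaining digits are bounded uniformly: two consecutive factors [phi] are not both
close to [q], because [(q - 1) b / p] is not an integer. *)

(** * Digit sums and divisor functions *)

(** Digits past the leading one vanish, so the number of positions summed can be adapted to the
    length of a block. *)
Lemma digit_sumE q n K : (1 < q)%N -> (n < q ^ K)%N ->
  digit_sum q n = (\sum_(i < K) (n %/ q ^ i) %% q)%N.
Proof.
move=> q1 nK; rewrite /digit_sum.
have big0 a : (n < q ^ a)%N ->
    (\sum_(i < maxn n.+1 K) (n %/ q ^ i) %% q = \sum_(i < a) (n %/ q ^ i) %% q)%N.
  move=> na; rewrite -!(big_mkord xpredT (fun i => (n %/ q ^ i) %% q)%N).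
  have [aM|Ma] := leqP a (maxn n.+1 K).
    rewrite (big_cat_nat (leq0n a) aM) //= [X in (_ + X)%N]big_nat_cond
      [X in (_ + X)%N]big1 ?addn0 // => i.
    rewrite andbT => /andP[ai _]; rewrite divn_small ?mod0n //.
    by apply: leq_trans na _; rewrite leq_pexp2l // ltnW.
  rewrite [RHS](big_cat_nat (leq0n _) (ltnW Ma)) //= [X in (_ + X)%N]big_nat_cond
      [X in (_ + X)%N]big1 ?addn0 // => i.
  rewrite andbT => /andP[ai _]; rewrite divn_small ?mod0n //.
  apply: leq_trans (ltn_expl n q1) _; rewrite leq_pexp2l ?(ltnW q1) //.
  by apply: leq_trans ai; rewrite (leq_trans (leqnSn n)) ?leq_maxl.
rewrite -(big0 _ nK) -(big0 n.+1) //.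
by apply: leq_trans (ltn_expl n q1) _; rewrite leq_pexp2l // ltnW.
Qed.

Lemma digit_sum_top q c M m : (1 < q)%N -> (c < q)%N -> (m < q ^ M)%N ->
  digit_sum q (c * q ^ M + m) = (c + digit_sum q m)%N.
Proof.
move=> q1 cq mM; have q0 : (0 < q)%N by rewrite ltnW.
have lt : (c * q ^ M + m < q ^ M.+1)%N.
  rewrite expnS; apply: (@leq_trans (c.+1 * q ^ M)); last by rewrite leq_mul2r cq orbT.
  by rewrite mulSn addnC ltn_add2r.
rewrite (digit_sumE q1 lt) (digit_sumE q1 mM) big_ord_recr /= addnC; congr addn.
  by rewrite divnMDl ?expn_gt0 ?q0 // divn_small // addn0 modn_small.
apply: eq_bigr => i _; have iM := ltn_ord i.
have -> : (c * q ^ M = c * q ^ (M - i).-1 * q * q ^ i)%N.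
  rewrite -!mulnA -expnS -expnD; congr (_ * _ ^ _)%N; lia.
by rewrite divnMDl ?expn_gt0 ?q0 // modnMDl.
Qed.

Lemma digit_sum0 q : digit_sum q 0 = 0%N.
Proof. by rewrite /digit_sum big_ord1 div0n mod0n. Qed.

(** The map [d |-> (gcd(d, m), d / gcd(d, m))] is injective on the divisors of [m n]; its components
    divide [m] and [n] respectively. *)
Lemma size_divisorsM m n : (0 < m)%N -> (0 < n)%N ->
  (size (divisors (m * n)) <= size (divisors m) * size (divisors n))%N.
Proof.
move=> m0 n0; rewrite -(size_allpairs (fun a b => (a, b)) (divisors m)).
pose f d := (gcdn d m, d %/ gcdn d m)%N.
have fI : {in divisors (m * n) &, injective f}.
  move=> d e _ _ [] gE dE.
  by rewrite -(divnK (dvdn_gcdl d m)) -(divnK (dvdn_gcdl e m)) dE gE.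
rewrite -(size_map f); apply: uniq_leq_size.
  by rewrite map_inj_in_uniq // divisors_uniq.
move=> y /mapP[d]; rewrite -dvdn_divisors ?muln_gt0 ?m0 // => dmn ->.
apply/allpairsP; exists (f d) => /=; split=> //.
  by rewrite -dvdn_divisors // dvdn_gcdr.
rewrite -dvdn_divisors //.
have g0 : (0 < gcdn d m)%N by rewrite gcdn_gt0 m0 orbT.
rewrite -(@Gauss_dvdr _ (m %/ gcdn d m)).
  rewrite -(dvdn_pmul2r g0) divnK ?dvdn_gcdl // mulnAC divnK ?dvdn_gcdr //.
by rewrite /coprime -(eqn_pmul2r g0) muln_gcdl !divnK ?dvdn_gcdl ?dvdn_gcdr // mul1n.
Qed.

Lemma size_divisors_pfactor p a : prime p -> (size (divisors (p ^ a)) <= a.+1)%N.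
Proof.
move=> pp; rewrite -[X in (_ <= X)%N](size_iota 0) -(size_map (fun i => p ^ i)%N (iota 0 _)).
apply: uniq_leq_size (divisors_uniq _) _ => d.
rewrite -dvdn_divisors ?expn_gt0 ?prime_gt0 // => /(dvdn_pfactor _ _ pp)[i ia ->].
by apply/mapP; exists i => //; rewrite mem_iota.
Qed.

Lemma poly_le_exp2 j : exists c, forall a, (a.+1 ^ j <= c * 2 ^ a)%N.
Proof.
case: j => [|j]; first by exists 1%N => a; rewrite mul1n expn_gt0.
exists (j.+1 ^ j.+1 * 2 ^ j.+1)%N => a.
(* With [t = a %/ (j + 1) + 1] one has [a + 1 <= (j + 1) t] and [t < 2 ^ t]; raised to the power
   [j + 1], the bound [2 ^ t] exceeds [2 ^ a] by at most the factor [2 ^ (j + 1)]. *)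
have e : (a.+1 <= j.+1 * (a %/ j.+1).+1)%N.
  by rewrite mulnC -ltnS ltnS ltn_ceil.
apply: (@leq_trans ((j.+1 * 2 ^ (a %/ j.+1).+1) ^ j.+1)%N).
  rewrite leq_exp2r // (leq_trans e) // leq_mul2l /=.
  by rewrite ltnW // ltn_expl.
rewrite expnMn -mulnA leq_mul2l; apply/orP; right.
by rewrite -expnM -expnD leq_exp2l // mulSn leq_add2l leq_divM.
Qed.

Lemma prod_prime_powers n : (0 < n)%N ->
  (n = \prod_(0 <= p < n.+1 | prime p) p ^ logn p n)%N.
Proof.
move=> n0; rewrite -[LHS](partnT n0) /partn [LHS]big_mkcond [RHS]big_mkcond /=.
by apply: eq_bigr => p _; case: ifP => // pp; rewrite lognE pp.
Qed.

Lemma size_divisors_le_prod n : (0 < n)%N ->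
  (size (divisors n) <= \prod_(0 <= p < n.+1 | prime p) (logn p n).+1)%N.
Proof.
move=> n0; rewrite {1}(prod_prime_powers n0).
suff [] : (0 < \prod_(0 <= p < n.+1 | prime p) p ^ logn p n)%N /\
  (size (divisors (\prod_(0 <= p < n.+1 | prime p) p ^ logn p n)) <=
   \prod_(0 <= p < n.+1 | prime p) (logn p n).+1)%N by [].
apply: (big_ind2 (fun a b => 0 < a /\ size (divisors a) <= b)%N) => //.
- move=> a b c d [a0 ab] [c0 cd]; split; first by rewrite muln_gt0 a0.
  exact: leq_trans (size_divisorsM a0 c0) (leq_mul ab cd).
- move=> p pp; split; first by rewrite expn_gt0 prime_gt0.
  exact: size_divisors_pfactor.
Qed.

(** A prime [p >= 2 ^ j] satisfies [(e + 1) ^ j <= (2 ^ j) ^ e <= p ^ e]. Each smaller prime costs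
    at most the factor [c] of [poly_le_exp2], and there are at most [2 ^ j] of them. *)
Lemma divisor_bound j : exists c, forall n, (0 < n)%N ->
  (size (divisors n) ^ j <= c * n)%N.
Proof.
have [c Hc] := poly_le_exp2 j.
have c0 : (0 < c)%N by have := Hc 0%N; rewrite exp1n; case: (c).
exists (c ^ (2 ^ j))%N => n n0.
have nE := prod_prime_powers n0.
apply: (@leq_trans ((\prod_(0 <= p < n.+1 | prime p) (logn p n).+1) ^ j)%N).
  by case: (j) => // j'; rewrite leq_exp2r // size_divisors_le_prod.
have -> : ((\prod_(0 <= p < n.+1 | prime p) (logn p n).+1) ^ j =
   \prod_(0 <= p < n.+1 | prime p) (logn p n).+1 ^ j)%N.
  by rewrite (big_morph (fun m => m ^ j)%N (fun a b => expnMn a b j) (exp1n j)).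
apply: (@leq_trans (\prod_(0 <= p < n.+1 | prime p)
   ((if p < 2 ^ j then c else 1) * p ^ logn p n))%N).
  apply: leq_prod => p pp; case: ltnP => pj.
    apply: leq_trans (Hc _) _; rewrite leq_mul2l.
    by case: (logn p n) => [|a]; rewrite ?orbT // leq_exp2r ?prime_gt1 ?orbT.
  rewrite mul1n; apply: (@leq_trans ((2 ^ logn p n) ^ j)%N).
    by case: (j) => // j'; rewrite leq_exp2r // ltn_expl.
  rewrite -expnM mulnC expnM.
  by case: (logn p n) => [|a] //; rewrite leq_exp2r.
rewrite big_split /= -nE leq_mul2r; apply/orP; right.
rewrite big_mkcond /=.
apply: (@leq_trans (\prod_(0 <= p < n.+1) (if p < 2 ^ j then c else 1))%N).
  by apply: leq_prod => p _; case: ifP => // _; case: ifP.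
have [le|lt] := leqP (2 ^ j) n.+1.
  rewrite (big_cat_nat (leq0n _) le) /= [X in (_ * X)%N]big_nat_cond.
  rewrite [X in (_ * X)%N]big1 ?muln1; last first.
    by move=> p; rewrite andbT => /andP[h _]; rewrite ltnNge h.
  rewrite (eq_big_nat _ _ (F2 := fun=> c)); last by move=> p /andP[_ ->].
  by rewrite prod_nat_const_nat subn0.
rewrite (eq_big_nat _ _ (F2 := fun=> c)); last first.
  by move=> p /andP[_ h]; rewrite (ltn_trans h).
by rewrite prod_nat_const_nat subn0 leq_pexp2l // ltnW.
Qed.

Lemma dvdn_bigprod (I : finType) (F : I -> nat) i : (F i %| \prod_j F j)%N.
Proof. by rewrite (bigD1 i) //= dvdn_mulr. Qed.

Lemma tau_le_divisors k n : (0 < n)%N -> (tau k n <= size (divisors n) ^ k)%N.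
Proof.
move=> n0; rewrite /tau.
apply: (@leq_trans #|@ffun_on_mem 'I_k 'I_n.+1 (mem [pred y : 'I_n.+1 | y %| n])|%N).
  apply: subset_leq_card; apply/fintype.subsetP => x; rewrite inE => /andP[_ /eqP e].
  apply/ffun_onP => i; rewrite inE.
  have := dvdn_bigprod (fun i => x i : nat) i; by rewrite e.
rewrite card_ffun_on card_ord; case: k => // k; rewrite leq_exp2r //.
rewrite cardE -(size_map val); apply: uniq_leq_size.
  by rewrite map_inj_uniq ?enum_uniq //; apply: val_inj.
by move=> d /mapP[y]; rewrite mem_enum inE => yn ->; rewrite -dvdn_divisors.
Qed.

(** * Sums over factorisations as nested sums *)

Lemma tau_widen k n X : (0 < n)%N -> (n <= X)%N ->
  tau k n = #|[set x : {ffun 'I_k -> 'I_X.+1} |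
                [forall i, 0 < x i] && (\prod_i (x i : nat) == n)]|%N.
Proof.
move=> n0 nX; have nX1 : (n.+1 <= X.+1)%N by [].
pose f (x : {ffun 'I_k -> 'I_n.+1}) := [ffun i => widen_ord nX1 (x i)].
have fI : injective f.
  by move=> x y /ffunP e; apply/ffunP => i; apply: val_inj; have := e i; rewrite !ffunE => -[].
rewrite /tau -(card_imset _ fI); apply: eq_card => x; rewrite inE.
apply/imsetP/idP => [[y + ->]|/andP[/forallP x0 /eqP e]].
  rewrite inE => /andP[/forallP y0 /eqP e]; apply/andP; split.
    by apply/forallP => i; rewrite ffunE /=; exact: y0.
  by apply/eqP; rewrite -[RHS]e; apply: eq_bigr => i _; rewrite ffunE.
have xn i : (x i < n.+1)%N.
  by rewrite ltnS dvdn_leq // -e;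
    exact: (dvdn_bigprod (fun i => x i : nat)).
exists [ffun i => inord (x i)]; last first.
  by apply/ffunP => i; apply: val_inj; rewrite !ffunE /= inordK.
rewrite inE; apply/andP; split.
  by apply/forallP => i; rewrite ffunE inordK.
by apply/eqP; rewrite -[RHS]e; apply: eq_bigr => i _; rewrite ffunE inordK.
Qed.

(** The sum of [h (x_1 ... x_k)] over all [x_i] in [[1, X]], in recursive form so that one variable
    can be split off at a time. *)
Fixpoint nested_sum (V : nmodType) (X k : nat) (h : nat -> V) : V :=
  if k is k'.+1 then \sum_(1 <= m < X.+1) nested_sum X k' (fun n => h (m * n)%N)
  else h 1%N.

Lemma nested_sum_ffun (V : nmodType) X k (h : nat -> V) :
  nested_sum X k h =
  \sum_(x : {ffun 'I_k -> 'I_X.+1} | [forall i, 0 < x i]%N) h (\prod_i (x i : nat))%N.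
Proof.
elim: k h => [|k IH] h /=.
  rewrite (big_pred1 [ffun=> ord0]) ?big_ord0 // => x /=.
  transitivity true; last by symmetry; apply/eqP/ffunP => -[].
  by apply/forallP => -[].
pose f (z : 'I_X.+1 * {ffun 'I_k -> 'I_X.+1}) : {ffun 'I_k.+1 -> 'I_X.+1} :=
  [ffun i => if unlift ord0 i is Some j then z.2 j else z.1].
pose g (x : {ffun 'I_k.+1 -> 'I_X.+1}) := (x ord0, [ffun j => x (lift ord0 j)]).
have fg : cancel f g.
  move=> [m y]; rewrite /g /f ffunE unlift_none; congr pair.
  by apply/ffunP => j; rewrite !ffunE liftK.
have gf : cancel g f.
  move=> x; apply/ffunP => i; rewrite ffunE /=.
  by case: unliftP => [j ->|->]; rewrite ?ffunE.
rewrite (reindex f); last by exists g => ? _; [exact: fg | exact: gf].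
rewrite big_add1 /= big_mkord.
transitivity (\sum_(m : 'I_X.+1 | (0 < m)%N)
   \sum_(y : {ffun 'I_k -> 'I_X.+1} | [forall i, 0 < y i]%N) h (m * \prod_i (y i : nat))%N).
  rewrite [RHS]big_mkcond big_ord_recl /= add0r.
  by apply: eq_bigr => i _; exact: IH.
rewrite pair_big_dep /=; apply: eq_big => [[m y]|[m y] _] /=.
  apply/andP/forallP => [[m0 /forallP y0] i|fm].
    by rewrite ffunE; case: unliftP => [j _|_] //=; exact: y0.
  split; first by have := fm ord0; rewrite ffunE unlift_none.
  by apply/forallP => j; have := fm (lift ord0 j); rewrite ffunE liftK.
rewrite big_ord_recl ffunE unlift_none /=; congr (h (_ * _)%N).
by apply: eq_bigr => j _; rewrite ffunE liftK.
Qed.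

(** Grouping tuples by their product produces [tau]; the vanishing of [h] beyond [X] discards the
    tuples with a larger product. *)
Lemma sum_tau_nested (V : nmodType) X k (h : nat -> V) :
  (forall n, (X < n)%N -> h n = 0) ->
  \sum_(1 <= n < X.+1) h n *+ tau k n = nested_sum X k h.
Proof.
move=> h0; rewrite nested_sum_ffun.
under eq_big_nat => n /andP[n0 nX] do rewrite (tau_widen _ n0 nX).
rewrite big_nat.
transitivity (\sum_(1 <= n < X.+1 | (0 < n < X.+1)%N)
    \sum_(x : {ffun 'I_k -> 'I_X.+1} | [forall i, 0 < x i]%N)
      if (\prod_i (x i : nat) == n)%N then h n else 0).
  apply: eq_bigr => n _; rewrite -sumr_const -big_mkcondr /=.
  by apply: eq_bigl => x; rewrite inE.
rewrite exchange_big /=; apply: eq_bigr => x /forallP x0.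
have [lt|le] := ltnP X (\prod_i (x i : nat))%N.
  rewrite h0 // big1 // => n /andP[_ nX]; case: eqP => // e.
  by move: lt; rewrite e ltnNge -ltnS nX.
rewrite -big_nat (bigD1_seq (\prod_i (x i : nat))%N) ?iota_uniq //=; last first.
  by rewrite mem_index_iota ltnS le andbT prodn_gt0.
by rewrite eqxx [X in _ + X]big1 ?addr0 // => n /negbTE; rewrite eq_sym => ->.
Qed.

Notation cabs := Normc.normc.

Section ComplexNorm.
Variable R : realType.
Implicit Types z w : R[i].

Lemma cabs_ge0 z : 0 <= cabs z.
Proof. by case: z => a b /=; exact: sqrtr_ge0. Qed.

Lemma cabsM z w : cabs (z * w) = cabs z * cabs w.
Proof. exact: Normc.normcM. Qed.

Lemma cabsD z w : cabs (z + w) <= cabs z + cabs w.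
Proof. exact: le_normcD. Qed.

Lemma cabsN z : cabs (- z) = cabs z.
Proof. exact: normcN. Qed.

Lemma cabsX z n : cabs (z ^+ n) = cabs z ^+ n.
Proof.
by elim: n => [|n IH]; rewrite ?expr0 ?Normc.normc1 // !exprS cabsM IH.
Qed.

Lemma cabs_nat n : cabs (n%:R : R[i]) = n%:R.
Proof. by rewrite -[n%:R]/(1 *+ n) (@normcMn R) Normc.normc1. Qed.

Lemma cabs_sum (I : Type) (r : seq I) (P : pred I) (F : I -> R[i]) :
  cabs (\sum_(i <- r | P i) F i) <= \sum_(i <- r | P i) cabs (F i).
Proof.
apply: (big_ind2 (fun z a => cabs z <= a)) => //; first by rewrite Normc.normc0.
by move=> z a w b za wb; apply: le_trans (cabsD _ _) _; exact: lerD.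
Qed.

End ComplexNorm.

Lemma nested_sum_exchange (V : nmodType) X k I (r : seq I) (F : I -> nat -> V) :
  \sum_(i <- r) nested_sum X k (F i) = nested_sum X k (fun n => \sum_(i <- r) F i n).
Proof.
elim: k F => [|k IH] F //=; rewrite exchange_big /=.
by apply: eq_bigr => m _; exact: IH.
Qed.

Lemma eq_nested_sum (V : nmodType) X k (F G : nat -> V) :
  F =1 G -> nested_sum X k F = nested_sum X k G.
Proof. by move=> /funext ->. Qed.

Lemma nested_sum_triangle (R : realType) X k (F : nat -> R[i]) (B : nat -> R) :
  (forall n, (0 < n)%N -> cabs (F n) <= B n) ->
  cabs (nested_sum X k F) <= nested_sum X k B.
Proof.
elim: k F B => [|k IH] F B FB /=; first exact: FB.
apply: le_trans (cabs_sum _ _ _) _; apply: ler_sum_nat => m /andP[m0 _].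
by apply: IH => n n0; apply: FB; rewrite muln_gt0 m0.
Qed.

Lemma nested_sum_ge0 (R : realType) X k (B : nat -> R) :
  (forall n, 0 <= B n) -> 0 <= nested_sum X k B.
Proof.
by elim: k B => [|k IH] B B0 //=; apply: sumr_ge0 => m _; exact: IH.
Qed.

(* Either all variables are at most [P], or one of them exceeds [P] and is
   summed first, the remaining ones being gathered in a single modulus. *)
Lemma nested_sum_split (R : realType) X P k (h : nat -> R[i]) (B : nat -> R) :
  (P <= X)%N -> (forall n, cabs (h n) <= 1) -> (forall n, 0 <= B n) ->
  (forall d, (0 < d)%N -> cabs (\sum_(P.+1 <= m < X.+1) h (d * m)%N) <= B d) ->
  forall c, (0 < c)%N ->
  cabs (nested_sum X k (fun n => h (c * n)%N)) <=
    P%:R ^+ k + k%:R * nested_sum X k (fun n => B (c * n)%N).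
Proof.
(* The multiplier [c] collects the variables already fixed: for an outer variable [m <= P] the
   induction hypothesis is applied with [c * m]. *)
move=> PX h1 B0 hB; elim: k => [|k IH] c c0 /=.
  by rewrite expr0 mul0r addr0.
have [X0|X0] := posnP X.
  by rewrite X0 big_nil Normc.normc0 big_nil mulr0 addr0 exprn_ge0.
rewrite (big_cat_nat (n := P.+1)) //=.
apply: le_trans (cabsD _ _) _.
(* An outer variable above [P] is moved inside all other sums, where [hB] applies with modulus
   [c * n]. *)
have -> : \sum_(P.+1 <= m < X.+1) nested_sum X k (fun n => h (c * (m * n))%N) =
    nested_sum X k (fun n => \sum_(P.+1 <= m < X.+1) h ((c * n) * m)%N).
  rewrite nested_sum_exchange; apply: eq_nested_sum => n.
  by apply: eq_bigr => m _; rewrite -mulnA (mulnC n).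
set J := \sum_(1 <= m < X.+1) _.
(* The left side is the term [m = 1] of [J]. *)
have hJ : nested_sum X k (fun n => B (c * n)%N) <= J.
  rewrite /J big_ltn // -[leLHS]addr0 lerD //.
    by under [leRHS]eq_nested_sum do rewrite mul1n.
  by apply: sumr_ge0 => m _; apply: nested_sum_ge0.
have h2 : cabs (nested_sum X k (fun n => \sum_(P.+1 <= m < X.+1) h (c * n * m)%N)) <= J.
  apply: le_trans hJ; apply: nested_sum_triangle => n n0.
  by apply: hB; rewrite muln_gt0 c0.
have h3 : cabs (\sum_(1 <= m < P.+1) nested_sum X k (fun n => h (c * (m * n))%N)) <=
    P%:R ^+ k.+1 + k%:R * J.
  apply: le_trans (cabs_sum _ _ _) _.
  apply: (@le_trans _ _ (\sum_(1 <= m < P.+1)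
      (P%:R ^+ k + k%:R * nested_sum X k (fun n => B (c * (m * n))%N)))).
    apply: ler_sum_nat => m /andP[m0 _].
    have := IH (c * m)%N; rewrite muln_gt0 c0 m0 => /(_ isT).
    by under eq_nested_sum do rewrite -mulnA;
       under [X in _ + _ * X]eq_nested_sum do rewrite -mulnA.
  rewrite big_split /= big_const_nat subn1 /= iter_addr_0 exprS mulr_natl.
  rewrite lerD2l -mulr_sumr ler_wpM2l //.
  rewrite /J [leRHS](big_cat_nat (n := P.+1)) //= lerDl.
  by apply: sumr_ge0 => m _; apply: nested_sum_ge0.
by apply: le_trans (lerD h3 h2) _; rewrite -addrA lerD2l -natr1 mulrDl mul1r.
Qed.

(** * Exponentials and the one-digit factor *)

Definition cis (R : realType) (t : R) : R[i] :=
  Complex (cos (2 * pi * t)) (sin (2 * pi * t)).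

Section Cis.
Import numFieldNormedType.Exports.
Variable R : realType.
Implicit Types s t : R.

Lemma cisD s t : cis (s + t) = cis s * cis t.
Proof.
by apply/eqP; rewrite eq_complex /= mulrDr cosD sinD eqxx (addrC (cos _ * sin _)) eqxx.
Qed.

Lemma cis0 : cis (0 : R) = 1.
Proof. by rewrite /cis mulr0 cos0 sin0. Qed.

Lemma cis1 : cis (1 : R) = 1.
Proof. by rewrite /cis mulr1 mulr_natl cos2pi sin2pi. Qed.

Lemma cisMn n s : cis (n%:R * s) = cis s ^+ n.
Proof.
elim: n => [|n IH]; first by rewrite mul0r cis0 expr0.
by rewrite -natr1 mulrDl mul1r cisD IH exprSr.
Qed.

Lemma cis_nat n : cis (n%:R : R) = 1.
Proof. by rewrite -[n%:R]mulr1 cisMn cis1 expr1n. Qed.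

Lemma cisDn s n : cis (s + n%:R) = cis s.
Proof. by rewrite cisD cis_nat mulr1. Qed.

Lemma cabs_cis s : cabs (cis s) = 1.
Proof. by rewrite /= cos2Dsin2 sqrtr1. Qed.

Lemma cabs_1Bcis s : cabs (1 - cis s) = 2 * `|sin (pi * s)|.
Proof.
have -> : cis s = Complex (cos ((pi * s) *+ 2)) (sin ((pi * s) *+ 2)).
  by rewrite /cis -mulrA mulr_natl.
rewrite /= cos_mulr2n sin_mulr2n.
have -> : (1 - (cos (pi * s) ^+ 2 *+ 2 - 1)) ^+ 2 + (0 - cos (pi * s) * sin (pi * s) *+ 2) ^+ 2
    = (2 * sin (pi * s)) ^+ 2 :> R.
  have := cos2Dsin2 (pi * s); move: (cos _) (sin _) => c d h.
  have -> : c ^+ 2 = 1 - d ^+ 2 by rewrite -h addrK.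
  have -> : (0 - c * d *+ 2) ^+ 2 = 4 * (1 - d ^+ 2) * d ^+ 2.
    by rewrite (_ : 1 - d ^+ 2 = c ^+ 2); [ring | rewrite -h addrK].
  ring.
by rewrite sqrtr_sqr normrM ger0_norm.
Qed.

(** Up to [1 / 4] by the mean value theorem, with [cos >= 1 / 2] and [pi >= 2]; beyond, monotonicity
    gives [sin (pi s) >= sin (pi / 4) >= 1 / 2 >= s]. *)
Lemma sin_pi_ge s : 0 <= s <= 2^-1 -> s <= sin (pi * s).
Proof.
move=> /andP[s0 s2]; have pi2 := @pi_ge2 R.
have cq : 2^-1 <= cos (pi / 4) :> R.
  have c0 : 0 <= cos (pi / 4) :> R by apply: cos_ge0_pihalf; lra.
  have := cos_mulr2n (pi / 4 : R).
  rewrite (_ : pi / 4 *+ 2 = pi / 2); last by rewrite -mulr_natr; field.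
  rewrite cos_pihalf => h; nra.
have sq : 2^-1 <= sin (pi / 4) :> R.
  have s0' : 0 <= sin (pi / 4) :> R by apply: sin_ge0_pi; lra.
  have := cos_mulr2n (pi / 4 : R); rewrite cos2sin2.
  rewrite (_ : pi / 4 *+ 2 = pi / 2); last by rewrite -mulr_natr; field.
  rewrite cos_pihalf => h; nra.
have [s4|s4] := leP s (4^-1); last first.
  apply: (le_trans s2); apply: (le_trans sq).
  rewrite le_eqVlt; apply/orP; right.
  by rewrite ltr_sin ?in_itv /=; nra.
have [] := @MVT_segment R sin cos 0 (pi * s).
- by rewrite mulr_ge0 // pi_ge0.
- exact/continuous_subspaceT/continuous_sin.
move=> c; rewrite in_itv /= => /andP[c0 c1]; rewrite sin0 !subr0 => ->.
have : 2^-1 <= cos c.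
  apply: le_trans cq _; rewrite le_eqVlt.
  have [->|ne] := eqVneq c (pi / 4); first by rewrite eqxx.
  apply/orP; right; rewrite ltr_cos ?in_itv /=; last 2 first.
  - by apply/andP; split; nra.
  - by apply/andP; split; nra.
  by rewrite lt_neqAle ne /=; nra.
move=> h; nra.
Qed.

Lemma cabs_1Bcis_ge s : 0 <= s <= 1 -> 2 * Num.min s (1 - s) <= cabs (1 - cis s).
Proof.
move=> /andP[s0 s1]; rewrite cabs_1Bcis ler_pM2l //.
apply: le_trans (ler_norm _).
have [h|h] := leP s (1 - s); first by apply: sin_pi_ge; lra.
have -> : sin (pi * s) = sin (pi * (1 - s)).
  by rewrite mulrBr mulr1 sinB sinpi cospi; ring.
by apply: sin_pi_ge; lra.
Qed.

End Cis.

Lemma sum_ord_mul (V : nmodType) a b (F : nat -> V) :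
  \sum_(n < a * b) F n = \sum_(t < a) \sum_(m < b) F (t * b + m)%N.
Proof.
elim: a => [|a IH]; first by rewrite !big_ord0.
rewrite big_ord_recr /= -IH -!(big_mkord xpredT).
rewrite (big_cat_nat (n := (a * b)%N)) //=; last by rewrite leq_mul2r leqnSn orbT.
congr (_ + _); rewrite -{1}[(a * b)%N]add0n big_addn mulSn addnK big_mkord.
by apply: eq_bigr => m _; rewrite addnC.
Qed.

Lemma sum_ord_shift (V : nmodType) q (F : nat -> V) m :
  (forall n, F (n + q)%N = F n) -> \sum_(t < q) F (m + t)%N = \sum_(t < q) F t.
Proof.
move=> Fq; elim: m => [|m <-]; first by apply: eq_bigr.
case: q Fq => [|q] Fq; first by rewrite !big_ord0.
rewrite big_ord_recr big_ord_recl /= addrC addn0; congr (_ + _).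
  by rewrite addSnnS Fq.
by apply: eq_bigr => t _; rewrite /bump /= add1n addSnnS.
Qed.

Lemma harmonic_le (R : realType) n : (0 < n)%N ->
  \sum_(1 <= u < n.+1) (u%:R^-1 : R) <= 1 + ln n%:R.
Proof.
elim: n => // -[|n] IH _; first by rewrite big_nat1 invr1 ln1 addr0.
rewrite big_nat_recr //=; apply: le_trans (lerD (IH isT) (lexx _)) _.
rewrite -addrA lerD2l -lerBrDl -[leRHS]opprB.
have n1 : 0 < n.+1%:R :> R by rewrite ltr0n.
have n2 : 0 < n.+2%:R :> R by rewrite ltr0n.
rewrite -ln_div ?posrE // lerNr.
have -> : n.+1%:R / n.+2%:R = 1 + - n.+2%:R^-1 :> R.
  have -> : n.+1%:R = n.+2%:R - 1 :> R by rewrite -[n.+2%:R]natr1 addrK.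
  by rewrite mulrBl divff ?gt_eqF // mul1r.
by rewrite le_ln1Dx // ltrN2 invf_lt1 // ltr1n.
Qed.

(** * Bounds for the factor of a single digit *)

Section DigitFactor.
Variable R : realType.
Variable q : nat.
Hypothesis q0 : (0 < q)%N.

Definition phi (s : R) : R := cabs (\sum_(c < q) cis s ^+ c).

Lemma phi_ge0 s : 0 <= phi s.
Proof. exact: cabs_ge0. Qed.

Lemma phi_le s : phi s <= q%:R.
Proof.
apply: le_trans (cabs_sum _ _ _) _.
rewrite (eq_bigr (fun=> 1)); last by move=> i _; rewrite cabsX cabs_cis expr1n.
by rewrite sumr_const card_ord.
Qed.

Lemma phi_mul s : phi s * cabs (1 - cis s) <= 2.
Proof.
rewrite /phi -cabsM -[1 - cis s]opprB mulrN cabsN mulrC -subrX1.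
apply: le_trans (cabsD _ _) _.
by rewrite cabsN cabsX cabs_cis expr1n Normc.normc1.
Qed.

(** For [s] in [[m / q, (m + 1) / q[] the geometric sum is at most the inverse distance from [s] to
    the nearest integer. The summands treat the integers below and above [s]; [maxn _ 1] gives the
    trivial bound [q] next to an integer. *)
Definition wt (m : nat) : R :=
  q%:R / (maxn (m %% q) 1)%:R + q%:R / (maxn (q.-1 - m %% q) 1)%:R.

Lemma wt_ge0 m : 0 <= wt m.
Proof. by rewrite addr_ge0 // divr_ge0. Qed.

Lemma wtDq m : wt (m + q) = wt m.
Proof. by rewrite /wt modnDr. Qed.

Lemma phi_wt m s : m%:R <= q%:R * s < m.+1%:R -> phi s <= wt m.
Proof.
move=> /andP[m1 m2]; rewrite /wt; set u := (m %% q)%N.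
have qp : 0 < q%:R :> R by rewrite ltr0n.
have uq : (u < q)%N by rewrite ltn_pmod.
have le0 (a : nat) : 0 <= q%:R / a%:R :> R by rewrite divr_ge0.
have [u0|u0] := posnP u.
  by rewrite u0 max0n divr1; apply: (le_trans (phi_le s)); rewrite lerDl.
have [v0|v0] := posnP (q.-1 - u)%N.
  by rewrite v0 max0n divr1; apply: (le_trans (phi_le s)); rewrite lerDr.
rewrite !(maxn_idPl _) //.
pose f := s - (m %/ q)%:R.
have -> : phi s = phi f by rewrite /phi -[in LHS](subrK (m %/ q)%:R s) cisDn.
have mE : m%:R = (m %/ q)%:R * q%:R + u%:R :> R by rewrite -natrM -natrD -divn_eq.
have f1 : u%:R <= q%:R * f by rewrite /f; move: m1; rewrite mE; lra.
have f2 : q%:R * f < u%:R + 1.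
  by rewrite /f; move: m2; rewrite -natr1 mE; lra.
have uR : 1 <= u%:R :> R by rewrite ler1n.
have vE : (q.-1 - u)%:R = q%:R - 1 - u%:R :> R.
  have : q%:R = (q.-1 - u)%:R + u%:R + 1 :> R.
    by rewrite -natrD natr1; congr _%:R; clear -uq; lia.
  by move=> ->; rewrite !addrK.
have vR : 1 <= (q.-1 - u)%:R :> R by rewrite ler1n.
have fp : 0 < f by rewrite -(pmulr_rgt0 _ qp); lra.
have fp1 : 0 < 1 - f by rewrite -(pmulr_rgt0 _ qp) mulrBr mulr1; lra.
have := phi_mul f; have := phi_ge0 f; move: (phi f) => F F0 F2.
have h : 2 * Num.min f (1 - f) <= cabs (1 - cis f) by apply: cabs_1Bcis_ge; lra.
have {}h : F * Num.min f (1 - f) <= 1 by have := le_trans (ler_wpM2l F0 h) F2; lra.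
move: h; have [c|c] := leP f (1 - f) => h.
  suff : F <= q%:R / u%:R by have := le0 (q.-1 - u)%N; lra.
  rewrite ler_pdivlMr; last by lra.
  apply: le_trans (ler_wpM2l F0 f1) _.
  by rewrite mulrCA -[leRHS]mulr1 ler_pM2l.
suff : F <= q%:R / (q.-1 - u)%:R by have := le0 u; lra.
rewrite ler_pdivlMr; last by lra.
have f3 : (q.-1 - u)%:R <= q%:R * (1 - f) by rewrite vE mulrBr mulr1; lra.
apply: le_trans (ler_wpM2l F0 f3) _.
by rewrite mulrCA -[leRHS]mulr1 ler_pM2l.
Qed.

(** A cell locates the argument only up to two neighbouring intervals of length [1 / q]; this weight
    serves both. *)
Definition wt2 m : R := wt m + wt m.+1.

Definition wsum : R := \sum_(t < q) wt2 t.

Lemma wt2_ge0 m : 0 <= wt2 m.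
Proof. by rewrite addr_ge0 // wt_ge0. Qed.

Lemma wt2Dq m t : wt2 (t * q + m) = wt2 m.
Proof. by rewrite /wt2 /wt -addnS !modnMDl. Qed.

Lemma wsum_shift m : \sum_(t < q) wt2 (m + t) = wsum.
Proof.
by apply: sum_ord_shift => n; rewrite -(wt2Dq n 1) mul1n addnC.
Qed.

Lemma phi_wt2 m s : m%:R <= q%:R * s < m.+2%:R -> phi s <= wt2 m.
Proof.
move=> /andP[m1 m2]; rewrite /wt2; have [le|lt] := leP m.+1%:R (q%:R * s).
  by apply: (@le_trans _ _ (wt m.+1)); rewrite ?phi_wt ?le // lerDr wt_ge0.
by apply: (@le_trans _ _ (wt m)); rewrite ?phi_wt ?m1 // lerDl wt_ge0.
Qed.

(** By periodicity and the reflection [t -> q - 1 - t], the sum is [4 q] times the sum of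
    [1 / max(t, 1)] over [t < q], in which [t = 0] adds 1 to a harmonic sum. *)
Lemma wsum_le : wsum <= 4 * q%:R * (2 + ln q%:R).
Proof.
have -> : wsum = 2 * \sum_(t < q) wt t.
  rewrite /wsum big_split /= mulr_natl mulr2n; congr (_ + _).
  exact: (@sum_ord_shift _ _ wt 1 wtDq).
have -> : \sum_(t < q) wt t = 2 * q%:R * \sum_(t < q) (maxn t 1)%:R^-1.
  rewrite big_split /= [X in _ + X](reindex_inj rev_ord_inj) /=.
  rewrite -mulrA mulr_natl mulr2n mulr_sumr; congr (_ + _); apply: eq_bigr => t _.
    by rewrite modn_small.
  have -> // : (q.-1 - (q - t.+1) %% q = t)%N.
  by have := ltn_ord t => tq; rewrite modn_small; lia.
suff h : \sum_(t < q) (maxn t 1)%:R^-1 <= 2 + ln q%:R :> R.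
  rewrite mulrA (_ : 2 * (2 * q%:R) = 4 * q%:R); last by ring.
  by rewrite ler_wpM2l.
rewrite -(big_mkord xpredT (fun t => (maxn t 1)%:R^-1)) big_ltn // max0n invr1.
rewrite (_ : 2 = 1 + 1 :> R) // -addrA lerD2l.
apply: le_trans (harmonic_le R q0).
rewrite big_nat_recr //= [X in X <= _](_ : _ = \sum_(1 <= u < q) (u%:R^-1 : R)); last first.
  by apply: eq_big_nat => u /andP[u1 _]; rewrite (maxn_idPl u1).
by rewrite lerDl invr_ge0.
Qed.

End DigitFactor.

(** * Majorants on cells and their total *)

Section Cells.
Variables (R : realType) (q : nat) (beta : R).
Hypothesis q0 : (0 < q)%N.
Hypothesis beta0 : 0 <= beta.

Let qp : 0 < q%:R :> R. Proof. by rewrite ltr0n. Qed.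
Let qXp n : 0 < q%:R ^+ n :> R. Proof. exact: exprn_gt0. Qed.

(* Any [alpha] in [j / q^L, (j + 1) / q^L[ has [q (q^i alpha + beta)] in
   [m, m + 2[ for [m = cell (L - i) j]. *)
Definition cell l j : nat := Num.truncn (q%:R * (j%:R / q%:R ^+ l + beta)).

Definition cell_majorant N L j : R := \prod_(i < N) wt2 R q (cell (L - i) j).

Lemma cell_majorant_ge0 N L j : 0 <= cell_majorant N L j.
Proof. by apply: prodr_ge0 => i _; exact: wt2_ge0. Qed.

Lemma cellD l v y j : (q * y = v * q ^ l)%N -> cell l (y + j) = (v + cell l j)%N.
Proof.
move=> e; rewrite /cell natrD mulrDl -addrA mulrDr.
have -> : q%:R * (y%:R / q%:R ^+ l) = v%:R :> R.
  by rewrite mulrA -natrM e natrM natrX mulfK // gt_eqF.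
rewrite truncnD ?natrK ?natr_nat // nnegrE mulr_ge0 // addr_ge0 //.
Qed.

(** The leading base-[q] digit [t] of [j] shifts the cell of the first factor by [t] and those of
    the later factors by multiples of [q], which leave [wt2] unchanged. Summing over [t] thus splits
    off one factor [wsum]. *)
Lemma cell_majorant_sum N L : (N <= L)%N ->
  \sum_(j < q ^ L) cell_majorant N L j = q%:R ^+ (L - N) * wsum R q ^+ N.
Proof.
elim: N L => [|N IH] L NL.
  rewrite subn0 expr0 mulr1 (eq_bigr (fun=> 1)); last by move=> j _; exact: big_ord0.
  by rewrite sumr_const card_ord natrX.
case: L NL => // L; rewrite ltnS => NL.
rewrite expnS sum_ord_mul exchange_big /= subSS exprSr mulrA -IH // mulr_suml.
apply: eq_bigr => j _; rewrite -(wsum_shift R q (cell L.+1 j)) mulr_sumr.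
apply: eq_bigr => t _; rewrite /cell_majorant big_ord_recl mulrC subn0; congr (_ * _).
  by apply: eq_bigr => i _; rewrite lift0 subSS;
     rewrite (@cellD _ (t * q ^ i * q)%N) ?wt2Dq // mulnC -!mulnA -expnS;
     congr (_ * _)%N; rewrite -expnSr -expnD; congr (_ ^ _)%N;
     have := leq_trans (ltn_ord i) NL; lia.
rewrite (@cellD _ t) ?[(t + _)%N]addnC // expnS mulnCA //.
Qed.

Lemma phi_le_cell_majorant N L j (alpha : R) : (N <= L)%N ->
  j%:R / q%:R ^+ L <= alpha < j.+1%:R / q%:R ^+ L ->
  \prod_(i < N) phi q (q%:R ^+ i * alpha + beta) <= cell_majorant N L j.
Proof.
move=> NL /andP[a1 a2]; apply: ler_prod => i _; rewrite phi_ge0 /=.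
have iL : (i < L)%N by apply: leq_trans (ltn_ord i) NL.
apply: phi_wt2 => //; rewrite /cell; set y := q%:R * _.
have y0 : 0 <= y by rewrite mulr_ge0 // addr_ge0 // divr_ge0 // ltW.
have /andP[t1 t2] := truncn_itv y0.
have eL : q%:R ^+ L = q%:R ^+ (L - i) * q%:R ^+ i :> R by rewrite -exprD subnK // ltnW.
have b1 : j%:R / q%:R ^+ (L - i) <= q%:R ^+ i * alpha.
  rewrite ler_pdivrMr // mulrC mulrA -eL mulrC.
  by move: a1; rewrite ler_pdivrMr.
have b2 : q%:R ^+ i * alpha < j.+1%:R / q%:R ^+ (L - i).
  rewrite ltr_pdivlMr // mulrC mulrA -eL mulrC.
  by move: a2; rewrite ltr_pdivlMr.
apply/andP; split.
  by apply: le_trans t1 _; rewrite /y ler_pM2l // lerD2r.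
rewrite -natr1 -[m in _ < m + 1]/(_.+1%:R); apply: lt_le_trans (_ : y + 1 <= _).
  (* Across the cell the argument moves by at most [q / q ^ (L - i) <= 1], as [i < L]; rounding down
     adds less than 1, hence a window of length 2. *)
  have : q%:R * (j.+1%:R / q%:R ^+ (L - i) + beta) <= y + 1.
    rewrite /y -natr1 [(j%:R + 1) / _]mulrDl mul1r !mulrDr addrAC -!addrA lerD2l lerD2l.
    rewrite ler_pdivrMr // mul1r -[leLHS]expr1 ler_weXn2l ?ler1n //.
    by rewrite subn_gt0.
  by apply: lt_le_trans; rewrite ltr_pM2l // ltrD2r.
by rewrite lerD2r ltW.
Qed.

End Cells.

(** * Exponential sums over multiples of a modulus *)

Section DigitExpSum.
Variables (R : realType) (q : nat) (beta : R).
Hypothesis q1 : (1 < q)%N.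

Let q0 : (0 < q)%N. Proof. exact: ltnW. Qed.

Definition digit_char n : R[i] := cis beta ^+ digit_sum q n.

Definition dsum Y (alpha : R) : R[i] := \sum_(n < Y) digit_char n * cis alpha ^+ n.

Definition dprod N (alpha : R) : R := \prod_(i < N) phi q (q%:R ^+ i * alpha + beta).

Lemma cabs_digit_char n : cabs (digit_char n) = 1.
Proof. by rewrite cabsX cabs_cis expr1n. Qed.

Lemma dprod_ge0 N alpha : 0 <= dprod N alpha.
Proof. by apply: prodr_ge0 => i _; exact: phi_ge0. Qed.

Lemma dsum_block c M Y alpha : (c < q)%N -> (Y <= q ^ M)%N ->
  \sum_(m < Y) digit_char (c * q ^ M + m) * cis alpha ^+ (c * q ^ M + m) =
  cis (q%:R ^+ M * alpha + beta) ^+ c * dsum Y alpha.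
Proof.
move=> cq YM; rewrite mulr_sumr; apply: eq_bigr => m _.
have mM : (m < q ^ M)%N by apply: leq_trans (ltn_ord m) YM.
rewrite /digit_char digit_sum_top // cisD -natrX cisMn !exprD !exprMn -!exprM.
by rewrite (mulnC (q ^ M)%N c) mulrACA; congr (_ * _); exact: mulrC.
Qed.

(** Both characters turn a leading digit into a separate phase, so the sum over a full block factors
    digit by digit. *)
Lemma cabs_dsum N alpha : cabs (dsum (q ^ N) alpha) = dprod N alpha.
Proof.
elim: N => [|N IH].
  rewrite /dsum expn0 big_ord1 /digit_char digit_sum0 !expr0 mulr1 Normc.normc1.
  by rewrite /dprod big_ord0.
rewrite /dprod big_ord_recr /= -/(dprod N alpha) -IH /phi -cabsM; congr cabs.
rewrite {1}/dsum expnS.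
rewrite (sum_ord_mul q (q ^ N) (fun n => digit_char n * cis alpha ^+ n)) mulr_sumr.
by apply: eq_bigr => c _; rewrite dsum_block // mulrC.
Qed.

(** Cutting at the leading digit of [Y] leaves fewer than [q] full blocks of length [q ^ M] and a
    shorter remainder, treated by induction. *)
Lemma dsum_le M Y alpha : (Y < q ^ M)%N ->
  cabs (dsum Y alpha) <= q%:R * \sum_(i < M) dprod i alpha.
Proof.
elim: M Y => [|M IH] Y YM.
  by move: YM; rewrite ltnS leqn0 => /eqP ->; rewrite /dsum !big_ord0 Normc.normc0 mulr0.
have qM : (0 < q ^ M)%N by rewrite expn_gt0 q0.
have yq : (Y %/ q ^ M < q)%N by rewrite ltn_divLR // -expnS.
have -> : dsum Y alpha =
    \sum_(n < Y %/ q ^ M * q ^ M + Y %% q ^ M) digit_char n * cis alpha ^+ n.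
  by rewrite -divn_eq.
rewrite big_split_ord /=.
rewrite (sum_ord_mul _ (q ^ M) (fun n => digit_char n * cis alpha ^+ n)).
rewrite dsum_block //; last by rewrite ltnW // ltn_pmod.
apply: le_trans (cabsD _ _) _; rewrite cabsM cabsX cabs_cis expr1n mul1r.
rewrite big_ord_recr /= mulrDr addrC lerD ?IH ?ltn_pmod //.
apply: le_trans (cabs_sum _ _ _) _.
apply: (@le_trans _ _ (\sum_(c < Y %/ q ^ M) dprod M alpha)).
  apply: ler_sum => c _; rewrite dsum_block //; last exact: ltn_trans yq.
  by rewrite cabsM cabsX cabs_cis expr1n mul1r cabs_dsum.
rewrite sumr_const card_ord -[leLHS]mulr_natl ler_wpM2r ?dprod_ge0 // ler_nat.
exact: ltnW.
Qed.

End DigitExpSum.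

(** A fraction with denominator [d] that is not an integer lies at distance at least [1 / d] from
    every integer. *)
Lemma cabs_1Bcis_rat (R : realType) n d : (0 < d)%N -> ~~ (d %| n)%N ->
  2 / d%:R <= cabs (1 - cis (n%:R / d%:R : R)).
Proof.
move=> d0 ndvd; have dp : 0 < d%:R :> R by rewrite ltr0n.
have -> : n%:R / d%:R = (n %% d)%:R / d%:R + (n %/ d)%:R :> R.
  by rewrite {1}(divn_eq n d) natrD natrM mulrDl mulfK ?gt_eqF // addrC.
rewrite cisDn; set s := (n %% d)%:R / _.
have s0 : d%:R^-1 <= s.
  by rewrite -[leLHS]mul1r ler_pM2r ?invr_gt0 // ler1n lt0n.
have s1 : d%:R^-1 <= 1 - s.
  rewrite lerBrDr -[X in X + _]mul1r -mulrDl ler_pdivrMr // mul1r nat1r.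
  by rewrite ler_nat ltn_pmod.
have dV : 0 < d%:R^-1 :> R by rewrite invr_gt0.
apply: le_trans (cabs_1Bcis_ge _); last by lra.
by rewrite ler_pM2l // le_min s0 s1.
Qed.

Lemma cis_orthogonality (R : realType) n d : (0 < d)%N ->
  \sum_(h < d) cis (h%:R / d%:R : R) ^+ n = if (d %| n)%N then d%:R else 0.
Proof.
move=> d0; have dp : 0 < d%:R :> R by rewrite ltr0n.
set z := cis (n%:R / d%:R : R).
have -> : \sum_(h < d) cis (h%:R / d%:R : R) ^+ n = \sum_(h < d) z ^+ h.
  apply: eq_bigr => h _; rewrite /z -!cisMn; congr cis; field.
  by rewrite gt_eqF.
case: ifP => [/dvdnP[m mE]|/negbT nd].
  rewrite (eq_bigr (fun=> 1)) ?sumr_const ?card_ord // => h _.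
  by rewrite /z mE natrM mulfK ?gt_eqF // cis_nat expr1n.
have zd : z ^+ d = 1.
  by rewrite /z -cisMn mulrC divfK ?gt_eqF // cis_nat.
have := subrX1 z d; rewrite zd subrr => /esym/eqP.
rewrite mulf_eq0 subr_eq0 => /orP[/eqP e|/eqP //].
have := cabs_1Bcis_rat R d0 nd; rewrite -/z e subrr Normc.normc0.
by rewrite leNgt divr_gt0.
Qed.

Lemma sum_multiples (V : nmodType) d Y Z (F : nat -> V) : (0 < d)%N ->
  (forall m, (d * m < Y)%N -> (m < Z)%N) ->
  \sum_(n < Y | (d %| n)%N) F n = \sum_(m < Z | (d * m < Y)%N) F (d * m)%N.
Proof.
move=> d0 YZ.
transitivity (\sum_(n < Y) \sum_(m < Z | (n == d * m :> nat)%N) F n).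
  rewrite big_mkcond; apply: eq_bigr => n _; case: ifP => [/dvdnP[m mE]|nd].
    have mZ : (m < Z)%N by apply: YZ; rewrite mulnC -mE.
    rewrite (big_pred1 (Ordinal mZ)) // => i.
    by rewrite /= mE mulnC eqn_pmul2l // eq_sym.
  rewrite big_pred0 // => m; apply/negbTE/eqP => e.
  by move/negP: nd; apply; rewrite e dvdn_mulr.
rewrite (exchange_big_dep xpredT) //= [RHS]big_mkcond; apply: eq_bigr => m _.
case: ifP => mY; first by rewrite (big_pred1 (Ordinal mY)).
by rewrite big_pred0 // => n; apply/negbTE/eqP => e; move: (ltn_ord n); rewrite e mY.
Qed.

Section ModulusSum.
Variables (R : realType) (q : nat) (beta : R).
Hypothesis q1 : (1 < q)%N.

Lemma digit_char_multiples d M Y : (0 < d)%N -> (Y < q ^ M)%N ->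
  cabs (\sum_(n < Y | (d %| n)%N) digit_char q beta n) <=
  q%:R / d%:R * \sum_(h < d) \sum_(i < M) dprod q beta i (h%:R / d%:R).
Proof.
move=> d0 YM; have dp : 0 < d%:R :> R by rewrite ltr0n.
rewrite mulrAC ler_pdivlMr // mulrC -[d%:R in leLHS](cabs_nat R) -cabsM.
have -> : d%:R * \sum_(n < Y | (d %| n)%N) digit_char q beta n =
    \sum_(h < d) dsum q beta Y (h%:R / d%:R).
  rewrite exchange_big big_mkcond mulr_sumr; apply: eq_bigr => n _.
  rewrite -mulr_sumr cis_orthogonality //.
  by case: ifP => _; rewrite ?mulr0 // mulrC.
apply: le_trans (cabs_sum _ _ _) _; rewrite mulr_sumr.
by apply: ler_sum => h _; exact: dsum_le.
Qed.

(** The cut lets every variable of a nested sum run up to [X] while only products up to [X]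
    contribute. *)
Definition cut_char X n : R[i] := if (n <= X)%N then digit_char q beta n else 0.

Lemma cut_char_multiples d M P X : (0 < d)%N -> (X.+1 < q ^ M)%N -> (P <= X)%N ->
  cabs (\sum_(P.+1 <= m < X.+1) cut_char X (d * m)) <=
  if (d * P <= X)%N then
    2 * q%:R / d%:R * \sum_(h < d) \sum_(i < M) dprod q beta i (h%:R / d%:R)
  else 0.
Proof.
move=> d0 XM PX; case: ifP => [dPX|/negbT]; last first.
  rewrite -ltnNge => dPX; rewrite big_nat big1 ?Normc.normc0 // => m /andP[mP _].
  by rewrite /cut_char leqNgt (leq_trans dPX) // leq_mul2l ltnW ?orbT.
(* The range [P < m <= X / d] is a difference of two initial ranges of multiples of [d], whence the
   factor 2. *)
have -> : \sum_(P.+1 <= m < X.+1) cut_char X (d * m) =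
    \sum_(n < X.+1 | (d %| n)%N) digit_char q beta n -
    \sum_(n < (d * P).+1 | (d %| n)%N) digit_char q beta n.
  rewrite (@sum_multiples _ d X.+1 X.+1) //; last first.
    by move=> m; apply: leq_ltn_trans; rewrite leq_pmull.
  rewrite (@sum_multiples _ d (d * P).+1 P.+1) //; last first.
    by move=> m; rewrite !ltnS leq_pmul2l.
  apply/eqP; rewrite eq_sym subr_eq addrC; apply/eqP.
  have -> : \sum_(m < X.+1 | (d * m < X.+1)%N) digit_char q beta (d * m) =
      \sum_(0 <= m < X.+1) cut_char X (d * m).
    by rewrite big_mkord big_mkcond.
  rewrite (big_cat_nat (n := P.+1)) //=; congr (_ + _).
  rewrite big_mkord [RHS]big_mkcond /=; apply: eq_bigr => m _.
  have mP : (m <= P)%N by rewrite -ltnS.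
  rewrite /cut_char ltnS leq_pmul2l // mP (leq_trans _ dPX) //.
  by rewrite leq_pmul2l.
apply: le_trans (cabsD _ _) _; rewrite cabsN -!mulrA mulr_natl mulr2n !mulrA.
apply: lerD; apply: digit_char_multiples => //.
exact: leq_ltn_trans XM.
Qed.

End ModulusSum.

(** * Uniform bound for products of digit factors *)

Section SupBound.
Variables (R : realType) (q p b : nat).
Hypothesis q1 : (1 < q)%N.
Hypothesis b0 : (0 < b)%N.
Hypothesis bp : (b < p)%N.
Hypothesis qp1 : coprime (q - 1) p.

Let q0 : (0 < q)%N. Proof. exact: ltnW. Qed.
Let qR : 0 < q%:R :> R. Proof. by rewrite ltr0n. Qed.
Let p0 : (0 < p)%N. Proof. exact: leq_ltn_trans bp. Qed.
Local Notation beta := (b%:R / p%:R : R).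

(** All terms but the first two are bounded by 1. With [t = |1 - e(s)|], the parallelogram law gives
    [|1 + e(s)| = sqrt (4 - t ^ 2) <= 2 - t ^ 2 / 4]. *)
Lemma phi_le_sub (s : R) : phi q s <= q%:R - cabs (1 - cis s) ^+ 2 / 4.
Proof.
have -> : phi q s = cabs (1 + cis s + \sum_(c < q.-2) cis s ^+ c.+2).
  rewrite /phi; congr cabs.
  case: q q1 => [|[|q']] // _; rewrite !big_ord_recl /= expr0 expr1 addrA.
  by congr (_ + _); apply: eq_bigr.
apply: le_trans (cabsD _ _) _.
have h1 : cabs (\sum_(c < q.-2) cis s ^+ c.+2) <= q%:R - 2.
  apply: le_trans (cabs_sum _ _ _) _.
  rewrite (eq_bigr (fun=> 1)); last by move=> i _; rewrite cabsX cabs_cis expr1n.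
  by rewrite sumr_const card_ord -subn2 natrB.
have : cabs (1 + cis s) ^+ 2 + cabs (1 - cis s) ^+ 2 = 4.
  rewrite /= !sqr_sqrtr ?addr_ge0 ?sqr_ge0 //.
  have := cos2Dsin2 (2 * pi * s); move: (cos _) (sin _) => c d h.
  rewrite (_ : 4 = 2 + 2 * (c ^+ 2 + d ^+ 2)); first by ring.
  by rewrite h; ring.
have := cabs_ge0 (1 + cis s); have := cabs_ge0 (1 - cis s).
move: (cabs (1 + _)) (cabs (1 - _)) h1 => x t h1 t0 x0 e.
suff : x <= 2 - t ^+ 2 / 4 by lra.
have t2 : t ^+ 2 <= 4 by rewrite -e lerDr sqr_ge0.
rewrite -(@ler_pXn2r _ 2) ?nnegrE //; last by lra.
have := sqr_ge0 (t ^+ 2); rewrite (_ : x ^+ 2 = 4 - t ^+ 2); last by lra.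
by move: (t ^+ 2) => u h; nra.
Qed.

(** Chosen so that [2 * gap * (q + 1) = 2 / p], the lower bound for [|1 - e((q - 1) b / p)|] that
    two consecutive factors have to share. *)
Definition gap : R := (p%:R * (q%:R + 1))^-1.

Lemma gap_gt0 : 0 < gap.
Proof. by rewrite invr_gt0 mulr_gt0 ?ltr0n // addr_gt0. Qed.

(* [s] and [q s - (q - 1) beta] cannot both be close to an
   integer, because [(q - 1) b / p] is not one. *)
Lemma phi_pair s s' : s' + (q - 1)%:R * beta = q%:R * s ->
  phi q s * phi q s' <= q%:R * (q%:R - gap ^+ 2).
Proof.
move=> e; pose w := cis ((q - 1)%:R * beta).
have wn : 2 / p%:R <= cabs (1 - w).
  rewrite /w mulrA -natrM; apply: cabs_1Bcis_rat => //.
  rewrite Gauss_dvdr; last by rewrite coprime_sym.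
  by rewrite gtnNdvd.
have wE : cis s' * w = cis s ^+ q by rewrite /w -cisD e cisMn.
have h : cabs (1 - w) <= q%:R * cabs (1 - cis s) + cabs (1 - cis s').
  have -> : 1 - w = (1 - cis s ^+ q) + (cis s' - 1) * w.
    by rewrite mulrBl mul1r wE addrA subrK.
  apply: le_trans (cabsD _ _) _; apply: lerD.
    rewrite -[1 - _ ^+ _]opprB cabsN subrX1 cabsM mulrC -[cis s - 1]opprB cabsN.
    by rewrite ler_wpM2r ?cabs_ge0 // phi_le.
  by rewrite cabsM /w cabs_cis mulr1 -opprB cabsN.
have gE : gap * (q%:R + 1) = p%:R^-1.
  by rewrite /gap invfM -mulrA mulVf ?mulr1 // gt_eqF // addr_gt0.
have g0 := gap_gt0.
have key u : 2 * gap <= cabs (1 - cis u) -> phi q u <= q%:R - gap ^+ 2.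
  move=> hu; apply: le_trans (phi_le_sub u) _; rewrite lerD2l lerN2.
  have : (2 * gap) ^+ 2 <= cabs (1 - cis u) ^+ 2.
    by rewrite ler_pXn2r ?nnegrE ?cabs_ge0 // mulr_ge0 // ltW.
  by rewrite exprMn; lra.
have [c|c] := leP (2 * gap) (cabs (1 - cis s)).
  by rewrite mulrC ler_pM ?phi_ge0 ?phi_le ?key.
rewrite ler_pM ?phi_ge0 ?phi_le ?key //.
have : 2 * (gap * (q%:R + 1)) <= q%:R * cabs (1 - cis s) + cabs (1 - cis s').
  by rewrite gE; exact: le_trans h.
have : q%:R * cabs (1 - cis s) <= q%:R * (2 * gap) by rewrite ler_pM2l // ltW.
lra.
Qed.

(** Consecutive factors are paired, each pair being at most [rho ^ 2]; a leftover single factor, at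
    most [q], accounts for [q / rho]. *)
Lemma dprod_sup rho N alpha : 0 < rho -> rho <= q%:R ->
  q%:R * (q%:R - gap ^+ 2) <= rho ^+ 2 ->
  dprod q beta N alpha <= q%:R / rho * rho ^+ N.
Proof.
move=> r0 rq rho2.
have [m le] := ubnP N; elim: m N le => // m IH [|[|N]] le.
- by rewrite /dprod big_ord0 expr0 mulr1 ler_pdivlMr // mul1r.
- by rewrite /dprod big_ord1 expr1 divfK ?gt_eqF // phi_le.
rewrite /dprod 2!big_ord_recr /= -mulrA -/(dprod q beta N alpha).
have -> : q%:R / rho * rho ^+ N.+2 = (q%:R / rho * rho ^+ N) * rho ^+ 2.
  by rewrite -[RHS]mulrA -exprD addn2.
apply: ler_pM; rewrite ?dprod_ge0 ?mulr_ge0 ?phi_ge0 //.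
  by apply: IH; rewrite -ltnS ltnW // ltnW.
apply: le_trans rho2; apply: phi_pair.
rewrite natrB // exprS; ring.
Qed.

Lemma dprodD L N alpha :
  dprod q beta (L + N) alpha = dprod q beta L alpha * dprod q beta N (q%:R ^+ L * alpha).
Proof.
rewrite /dprod big_split_ord /=; congr (_ * _); apply: eq_bigr => i _.
by rewrite exprD mulrA [_ ^+ i * _]mulrC.
Qed.

End SupBound.

Lemma ler_sum_inj (R : realType) (I J : finType) (A : {pred I}) (f : I -> J)
    (F : I -> R) (G : J -> R) :
  {in A &, injective f} -> (forall x, x \in A -> F x <= G (f x)) ->
  (forall y, 0 <= G y) -> \sum_(x in A) F x <= \sum_y G y.
Proof.
move=> fI FG G0; apply: le_trans (ler_sum _ FG) _.
rewrite -(big_imset G fI) /= [leRHS](bigID (mem (f @: A))) /= lerDl.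
exact: sumr_ge0.
Qed.

(** * Summation over Farey fractions *)

Section Farey.
Variables (R : realType) (q p b : nat).
Hypothesis q1 : (1 < q)%N.
Hypothesis b0 : (0 < b)%N.
Hypothesis bp : (b < p)%N.
Hypothesis qp1 : coprime (q - 1) p.

Let q0 : (0 < q)%N. Proof. exact: ltnW. Qed.
Let qR : 0 < q%:R :> R. Proof. by rewrite ltr0n. Qed.
Let qXR n : 0 < q%:R ^+ n :> R. Proof. exact: exprn_gt0. Qed.
Local Notation beta := (b%:R / p%:R : R).
Local Notation G := (dprod q beta).
Local Notation w := (wsum R q).

Let beta0 : 0 <= beta. Proof. by rewrite divr_ge0. Qed.

(** Distinct reduced fractions differ by at least [1 / (r r') >= 1 / T], so they cannot share a cell
    of length [1 / T]. *)
Lemma farey_cell_inj T a r a' r' : (0 < r)%N -> (0 < r')%N -> (r * r' <= T)%N ->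
  coprime a r -> coprime a' r' ->
  (a * T %/ r = a' * T %/ r')%N -> a = a' /\ r = r'.
Proof.
have half x y z y' : (0 < y)%N -> (0 < y')%N -> (y * y' <= T)%N ->
    (x * T %/ y = z * T %/ y')%N -> (x * y' <= z * y)%N.
  move=> y0 y'0 yyT e.
  have T0 : (0 < T)%N by apply: leq_trans yyT; rewrite muln_gt0 y0.
  have l1 := ltn_ceil (x * T) y0; have l2 := leq_divM (z * T) y'.
  rewrite leqNgt; apply/negP => lt.
  have h1 : ((z * y + 1) * T <= x * y' * T)%N by rewrite leq_mul2r addn1 lt orbT.
  move: l1 l2; rewrite e; set j := (z * T %/ y')%N => l1 l2.
  have h2 : (x * T * y' < j.+1 * y * y')%N by rewrite ltn_mul2r y'0.
  have h3 : (j * y' * y <= z * T * y)%N by rewrite leq_mul2r l2 orbT.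
  nia.
move=> r0 r'0 rT ca ca' e.
have e2 : (a * r' = a' * r)%N.
  apply/eqP; rewrite eqn_leq; apply/andP; split; first exact: half e.
  by apply: half (esym e) => //; rewrite mulnC.
have rr' : r = r'.
  apply/eqP; rewrite eqn_dvd; apply/andP; split.
    by rewrite -(@Gauss_dvdr _ a) 1?coprime_sym // e2 dvdn_mull.
  by rewrite -(@Gauss_dvdr _ a') 1?coprime_sym // -e2 dvdn_mull.
by split=> //; move: e2; rewrite rr' => /eqP; rewrite eqn_pmul2r // => /eqP.
Qed.

(** Denominators below [q ^ (i + 1)] have products at most [q ^ (2 i + 2)], so each cell of that
    level holds at most one fraction and the sum is dominated by the majorant summed over all
    cells. *)
Lemma farey_block_le i n : (n <= i.*2.+2)%N ->
  \sum_(q ^ i <= r < q ^ i.+1) \sum_(a < r | coprime a r) G n (a%:R / r%:R) <=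
  q%:R ^+ (i.*2.+2 - n) * w ^+ n.
Proof.
move=> nL; set L := i.*2.+2.
have qL : (0 < q ^ L)%N by rewrite expn_gt0 q0.
rewrite -(cell_majorant_sum q0 beta0 nL) -/L.
have -> : \sum_(q ^ i <= r < q ^ i.+1) \sum_(a < r | coprime a r) G n (a%:R / r%:R) =
    \sum_(r < q ^ i.+1 | (q ^ i <= r)%N)
      \sum_(a < q ^ i.+1 | coprime a r && (a < r)%N) G n (a%:R / r%:R).
  rewrite (@big_nat_widenl _ _ _ _ 0) // big_mkord /=; apply: eq_bigr => r _.
  exact: (big_ord_widen_cond _ (fun a => coprime a r)
    (fun a => G n (a%:R / r%:R)) (ltnW (ltn_ord r))).
rewrite pair_big_dep /=.
pose f (x : 'I_(q ^ i.+1) * 'I_(q ^ i.+1)) : 'I_(q ^ L) :=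
  Ordinal (ltn_pmod (x.2 * q ^ L %/ x.1) qL).
pose A : {pred 'I_(q ^ i.+1) * 'I_(q ^ i.+1)} :=
  [pred x : 'I_(q ^ i.+1) * 'I_(q ^ i.+1) | (q ^ i <= x.1)%N && (coprime x.2 x.1 && (x.2 < x.1)%N)].
have fE x : x \in A -> f x = (x.2 * q ^ L %/ x.1)%N :> nat.
  move=> /andP[x1 /andP[_ x2]]; rewrite /= modn_small // ltn_divLR.
    by rewrite mulnC ltn_mul2l qL.
  exact: leq_ltn_trans x2.
have := @ler_sum_inj R _ _ A f (fun x => G n (x.2%:R / x.1%:R))
  (fun j => cell_majorant q beta n L j).
apply.
- move=> [r a] [r' a'] xA yA /(congr1 val); rewrite /= -!/(f (_, _) : nat).
  move: (fE _ xA) (fE _ yA); rewrite /= => -> ->.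
  move: xA yA => /andP[/= r0 /andP[ca _]] /andP[/= r'0 /andP[ca' _]] e.
  have qi : (0 < q ^ i)%N by rewrite expn_gt0 q0.
  have [//|//||//|//|e1 e2] := @farey_cell_inj _ _ _ _ _ _ _ _ _ _ e.
  + exact: leq_trans r0.
  + exact: leq_trans r'0.
  + apply: leq_trans (leq_mul (ltnW (ltn_ord r)) (ltnW (ltn_ord r'))) _.
    by rewrite -expnD leq_exp2l // /L -addnn; lia.
  by congr pair; apply: val_inj.
- move=> x xA; rewrite fE //; move: xA => /andP[r1 /andP[_ ar]].
  have r0 : (0 < x.1)%N by apply: leq_ltn_trans ar.
  have rp : 0 < x.1%:R :> R by rewrite ltr0n.
  apply: phi_le_cell_majorant => //; apply/andP; split.
    rewrite ler_pdivrMr // mulrAC ler_pdivlMr // -natrX -!natrM ler_nat.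
    exact: leq_divM.
  rewrite ltr_pdivlMr // mulrAC ltr_pdivrMr // -natrX -!natrM ltr_nat.
  exact: ltn_ceil.
- by move=> j; exact: cell_majorant_ge0.
Qed.

(** The first [2 i + 2] factors are summed over the cells, the remaining ones are bounded uniformly
    by [dprod_sup]. *)
Lemma farey_block_gt rho i n : 0 < rho -> rho <= q%:R ->
  q%:R * (q%:R - gap R q p ^+ 2) <= rho ^+ 2 -> (i.*2.+2 <= n)%N ->
  \sum_(q ^ i <= r < q ^ i.+1) \sum_(a < r | coprime a r) G n (a%:R / r%:R) <=
  w ^+ i.*2.+2 * (q%:R / rho * rho ^+ (n - i.*2.+2)).
Proof.
move=> r0 rq rho2 nL; have := farey_block_le (leqnn i.*2.+2).
rewrite subnn expr0 mul1r => h.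
have c0 : 0 <= q%:R / rho * rho ^+ (n - i.*2.+2).
  by rewrite mulr_ge0 ?exprn_ge0 ?divr_ge0 // ltW.
apply: le_trans (ler_wpM2r c0 h); rewrite mulr_suml; apply: ler_sum => r _.
rewrite mulr_suml; apply: ler_sum => a _.
rewrite -[in leLHS](subnKC nL) dprodD ler_wpM2l ?dprod_ge0 //.
exact: dprod_sup.
Qed.

(** For [n <= 2 i + 2] the block is at most [q ^ (i + 2) (w / q) ^ n], and [q ^ i <= D]. For larger
    [n], the condition [w ^ 2 <= q rho ^ 2] turns [w ^ (2 i + 2) / q ^ i] into at most
    [q rho ^ (2 i + 2)], which completes the power of [rho]. *)
Lemma block_bound rho i n D : 1 <= rho -> rho <= q%:R ->
  q%:R * (q%:R - gap R q p ^+ 2) <= rho ^+ 2 -> w ^+ 2 <= q%:R * rho ^+ 2 ->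
  (q ^ i <= D)%N ->
  \sum_(q ^ i <= r < q ^ i.+1) r%:R^-1 * \sum_(a < r | coprime a r) G n (a%:R / r%:R) <=
  q%:R ^+ 2 * D%:R * (w / q%:R) ^+ n + q%:R ^+ 2 / rho * rho ^+ n.
Proof.
move=> rho1 rq rho2 w2 iD; have rho0 : 0 < rho by apply: lt_le_trans rho1.
have w0 : 0 <= w by apply: sumr_ge0 => t _; exact: wt2_ge0.
apply: (@le_trans _ _ (q%:R ^- i * \sum_(q ^ i <= r < q ^ i.+1)
    \sum_(a < r | coprime a r) G n (a%:R / r%:R))).
  rewrite mulr_sumr; apply: ler_sum_nat => r /andP[r1 _].
  rewrite ler_wpM2r //; first by apply: sumr_ge0 => a _; exact: dprod_ge0.
  rewrite lef_pV2 ?posrE //; first by rewrite -natrX ler_nat.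
  by rewrite ltr0n; apply: leq_trans r1; rewrite expn_gt0 q0.
have A0 : 0 <= q%:R ^+ 2 * D%:R * (w / q%:R) ^+ n :> R.
  by rewrite !mulr_ge0 ?exprn_ge0 ?divr_ge0 // ltW.
have B0 : 0 <= q%:R ^+ 2 / rho * rho ^+ n.
  by rewrite mulr_ge0 ?exprn_ge0 ?divr_ge0 // ?exprn_ge0 // ltW.
have [nL|Ln] := leqP n i.*2.+2.
  rewrite -[leLHS]addr0 lerD //.
  rewrite mulrC ler_pdivrMr //; apply: le_trans (farey_block_le nL) _.
  rewrite expr_div_n mulrA [leRHS]mulrAC ler_pdivlMr //.
  rewrite mulrAC -exprD subnK // -[leRHS]mulrA [leRHS]mulrAC.
  have -> : q%:R ^+ i.*2.+2 = q%:R ^+ 2 * q%:R ^+ i * q%:R ^+ i :> R.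
    by rewrite -!exprD -addnn.
  have -> : q%:R ^+ 2 * (w ^+ n * q%:R ^+ i) * D%:R =
      q%:R ^+ 2 * q%:R ^+ i * D%:R * w ^+ n.
    by move: (q%:R ^+ i) (w ^+ n) => x y; ring.
  rewrite ler_wpM2r ?exprn_ge0 // ler_pM2l ?mulr_gt0 //.
  by rewrite -natrX ler_nat.
rewrite -[leLHS]add0r lerD // mulrC ler_pdivrMr //.
apply: le_trans (farey_block_gt rho0 rq rho2 (ltnW Ln)) _.
have -> : w ^+ i.*2.+2 = (w ^+ 2) ^+ i.+1 by rewrite -exprM mul2n.
have h : (w ^+ 2) ^+ i.+1 <= (q%:R * rho ^+ 2) ^+ i.+1.
  by rewrite ler_pXn2r ?nnegrE ?mulr_ge0 ?exprn_ge0 // ltW.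
have c0 : 0 <= q%:R / rho * rho ^+ (n - i.*2.+2).
  by rewrite mulr_ge0 ?exprn_ge0 ?divr_ge0 // ltW.
apply: le_trans (ler_wpM2r c0 h) _.
rewrite exprMn -exprM mul2n -doubleS -[in leRHS](subnKC (ltnW Ln)) exprD exprS.
rewrite le_eqVlt; apply/orP; left; apply/eqP.
by move: (rho ^+ _) (rho ^+ _) (q%:R ^+ i) => x y z; field; rewrite gt_eqF.
Qed.

Lemma farey_bound rho n D : (0 < D)%N -> 1 <= rho -> rho <= q%:R ->
  q%:R * (q%:R - gap R q p ^+ 2) <= rho ^+ 2 -> w ^+ 2 <= q%:R * rho ^+ 2 ->
  \sum_(1 <= r < D.+1) r%:R^-1 * \sum_(a < r | coprime a r) G n (a%:R / r%:R) <=
  (trunc_log q D).+1%:R *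
    (q%:R ^+ 2 * D%:R * (w / q%:R) ^+ n + q%:R ^+ 2 / rho * rho ^+ n).
Proof.
move=> D0 rho1 rq rho2 w2; set c := (X in _ <= _ * X).
pose F r : R := r%:R^-1 * \sum_(a < r | coprime a r) G n (a%:R / r%:R).
have F0 r : 0 <= F r.
  by rewrite mulr_ge0 ?invr_ge0 //; apply: sumr_ge0 => a _; exact: dprod_ge0.
have /andP[D1 D2] := trunc_log_bounds q1 D0.
have split m : \sum_(1 <= r < q ^ m) F r = \sum_(i < m) \sum_(q ^ i <= r < q ^ i.+1) F r.
  elim: m => [|m IH]; first by rewrite big_ord0 big_geq.
  rewrite big_ord_recr /= -IH -big_cat_nat ?expn_gt0 ?q0 //.
  by rewrite leq_exp2l.
apply: (@le_trans _ _ (\sum_(1 <= r < q ^ (trunc_log q D).+1) F r)).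
  by rewrite [leRHS](big_cat_nat (n := D.+1)) //= lerDl; apply: sumr_ge0 => r _.
rewrite split; apply: (@le_trans _ _ (\sum_(i < (trunc_log q D).+1) c)).
  apply: ler_sum => i _; apply: block_bound => //.
  by apply: leq_trans D1; rewrite leq_exp2l // -ltnS.
by rewrite sumr_const card_ord mulr_natl.
Qed.

(** With [e = gcd(h, d)], [d = e r] and [h = e a], the weight [1 / d] splits as [1 / e] times
    [1 / r], and [(d, h) |-> (e, (r, a))] is injective; the right side sums over all such
    triples. *)
Lemma lowest_terms (g : R -> R) D : (forall x, 0 <= g x) ->
  \sum_(1 <= d < D.+1) d%:R^-1 * \sum_(h < d) g (h%:R / d%:R) <=
  (\sum_(1 <= e < D.+1) e%:R^-1) *
  \sum_(1 <= r < D.+1) r%:R^-1 * \sum_(a < r | coprime a r) g (a%:R / r%:R).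
Proof.
move=> g0.
have E (P : nat -> pred nat) : \sum_(1 <= d < D.+1) d%:R^-1 *
     \sum_(h < d | P d h) g (h%:R / d%:R) =
   \sum_(x : 'I_D.+1 * 'I_D.+1 | (0 < x.1)%N && (P x.1 x.2 && (x.2 < x.1)%N))
     x.1%:R^-1 * g (x.2%:R / x.1%:R).
  rewrite (@big_nat_widenl _ _ _ _ 0) // big_mkord /=.
  rewrite -(pair_big_dep (fun x : 'I_D.+1 => 0 < x)%N
    (fun x y : 'I_D.+1 => P x y && (y < x)%N)
    (fun x y => x%:R^-1 * g (y%:R / x%:R))) /=.
  apply: eq_bigr => d _; rewrite -mulr_sumr; congr (_ * _).
  exact: (big_ord_widen_cond _ (P d) (fun a => g (a%:R / d%:R)) (ltnW (ltn_ord d))).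
rewrite (E (fun=> xpredT)) (E (fun r a => coprime a r)).
rewrite (@big_nat_widenl _ _ _ _ 0) // big_mkord /= mulr_suml.
have I3 : forall F : 'I_D.+1 -> 'I_D.+1 * 'I_D.+1 -> R,
  \sum_(e : 'I_D.+1 | (0 < e)%N) \sum_(x : 'I_D.+1 * 'I_D.+1 |
    (0 < x.1)%N && (coprime x.2 x.1 && (x.2 < x.1)%N)) F e x =
  \sum_(y : 'I_D.+1 * ('I_D.+1 * 'I_D.+1)) if (0 < y.1)%N &&
    ((0 < y.2.1)%N && (coprime y.2.2 y.2.1 && (y.2.2 < y.2.1)%N)) then F y.1 y.2 else 0.
  by move=> F; rewrite pair_big -big_mkcond.
under [leRHS]eq_bigr do rewrite mulr_sumr.
rewrite I3.
pose A : {pred 'I_D.+1 * 'I_D.+1} :=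
  [pred x : 'I_D.+1 * 'I_D.+1 | (0 < x.1)%N && (true && (x.2 < x.1)%N)].
pose e (x : 'I_D.+1 * 'I_D.+1) := gcdn x.2 x.1.
pose f (x : 'I_D.+1 * 'I_D.+1) : 'I_D.+1 * ('I_D.+1 * 'I_D.+1) :=
  (inord (e x), (inord (x.1 %/ e x), inord (x.2 %/ e x)))%N.
have spec x : x \in A -> [/\ (0 < e x)%N, (f x).1 = e x :> nat,
    (f x).2.1 = (x.1 %/ e x)%N :> nat & (f x).2.2 = (x.2 %/ e x)%N :> nat].
  move=> /andP[x1 /= x2]; have e0 : (0 < e x)%N by rewrite gcdn_gt0 x1 orbT.
  split=> //=; rewrite inordK //.
  - by rewrite ltnS (leq_trans (dvdn_leq x1 (dvdn_gcdr _ _))) // -ltnS.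
  - by rewrite ltnS (leq_trans (leq_div _ _)) // -ltnS.
  - by rewrite ltnS (leq_trans (leq_div _ _)) // -ltnS.
have := @ler_sum_inj R _ _ A f (fun x => x.1%:R^-1 * g (x.2%:R / x.1%:R)).
apply.
- move=> x y xA yA fE.
  have [ex0 fx1 fx2 fx3] := spec _ xA; have [ey0 fy1 fy2 fy3] := spec _ yA.
  have eE : e x = e y by rewrite -fx1 -fy1 fE.
  have h1 : (x.1 %/ e x = y.1 %/ e y)%N by rewrite -fx2 -fy2 fE.
  have h2 : (x.2 %/ e x = y.2 %/ e y)%N by rewrite -fx3 -fy3 fE.
  rewrite [x]surjective_pairing [y]surjective_pairing; congr pair; apply: val_inj => /=.
    by rewrite -(divnK (dvdn_gcdr x.2 x.1)) -(divnK (dvdn_gcdr y.2 y.1)) -/(e x) -/(e y) h1 eE.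
  by rewrite -(divnK (dvdn_gcdl x.2 x.1)) -(divnK (dvdn_gcdl y.2 y.1)) -/(e x) -/(e y) h2 eE.
- move=> x xA; have [ex0 -> -> ->] := spec _ xA.
  move: xA => /andP[x1 /= x2].
  have d1 : (e x %| x.1)%N by exact: dvdn_gcdr.
  have d2 : (e x %| x.2)%N by exact: dvdn_gcdl.
  rewrite ex0 divn_gt0 // (dvdn_leq x1 d1) ltn_divLR // divnK // x2 andbT /=.
  have -> : coprime (x.2 %/ e x) (x.1 %/ e x).
    by rewrite /coprime -(eqn_pmul2r ex0) muln_gcdl !divnK // mul1n.
  have eR : (e x)%:R != 0 :> R by rewrite pnatr_eq0 -lt0n.
  have -> : x.2%:R / x.1%:R = (x.2 %/ e x)%:R / (x.1 %/ e x)%:R :> R.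
    by rewrite -[in LHS](divnK d1) -[in LHS](divnK d2) !natrM -mulf_div divff // mulr1.
  have -> : x.1%:R^-1 = (e x)%:R^-1 * (x.1 %/ e x)%:R^-1 :> R.
    by rewrite -[in LHS](divnK d1) natrM invfM mulrC.
  by rewrite mulrA.
- move=> y; case: ifP => // _; rewrite !mulr_ge0 ?invr_ge0 //.
Qed.

Lemma char_sum_bound rho k X P M (W : R) : 1 <= rho -> rho <= q%:R ->
  q%:R * (q%:R - gap R q p ^+ 2) <= rho ^+ 2 -> w ^+ 2 <= q%:R * rho ^+ 2 ->
  (0 < P)%N -> (P <= X)%N -> (X.+1 < q ^ M)%N ->
  (forall d, (0 < d <= X)%N -> (tau k d)%:R <= W) ->
  cabs (\sum_(1 <= n < X.+1) digit_char q beta n *+ tau k n) <=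
  P%:R ^+ k + k%:R * (W * (2 * q%:R * ((\sum_(1 <= e < (X %/ P).+1) e%:R^-1) *
    \sum_(n < M) (trunc_log q (X %/ P)).+1%:R *
      (q%:R ^+ 2 * (X %/ P)%:R * (w / q%:R) ^+ n + q%:R ^+ 2 / rho * rho ^+ n)))).
Proof.
move=> rho1 rq rho2 w2 P0 PX XM tW; set D := (X %/ P)%N.
have D0 : (0 < D)%N by rewrite divn_gt0.
pose B d : R := if (d * P <= X)%N then
  2 * q%:R / d%:R * \sum_(h < d) \sum_(i < M) G i (h%:R / d%:R) else 0.
have B0 d : 0 <= B d.
  rewrite /B; case: ifP => // _; rewrite mulr_ge0 ?divr_ge0 //.
  by apply: sumr_ge0 => h _; apply: sumr_ge0 => i _; exact: dprod_ge0.
have -> : \sum_(1 <= n < X.+1) digit_char q beta n *+ tau k n =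
    nested_sum X k (cut_char q beta X).
  rewrite -sum_tau_nested; last by move=> n nX; rewrite /cut_char leqNgt nX.
  by apply: eq_big_nat => n /andP[_ nX]; rewrite /cut_char -ltnS nX.
have hc n : cabs (cut_char q beta X n) <= 1.
  by rewrite /cut_char; case: ifP => _; rewrite ?cabs_digit_char ?Normc.normc0.
have := nested_sum_split k PX hc B0 _ (ltnSn 0).
under eq_nested_sum do rewrite mul1n.
rewrite (_ : (fun n => B (1 * n)%N) = B); last by apply/funext => n; rewrite mul1n.
move=> h; apply: le_trans (h _) _.
  by move=> d d0; exact: cut_char_multiples.
(* Read backwards, the nested sum of [B] weights each modulus [d] by [tau k d], bounded by [W]; [B]
   vanishes for [d > X / P]. *)
rewrite lerD2l ler_wpM2l // -sum_tau_nested; last first.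
  move=> n nX; rewrite /B leqNgt (leq_trans nX) ?leq_pmulr //.
apply: (@le_trans _ _ (\sum_(1 <= n < X.+1) W * B n)).
  apply: ler_sum_nat => n /andP[n0 nX]; rewrite -[leLHS]mulr_natl ler_wpM2r //.
  by apply: tW; rewrite n0 -ltnS.
have W0 : 0 <= W.
  by apply: le_trans (tW 1%N _) => //; rewrite (leq_trans P0 PX).
rewrite -mulr_sumr ler_wpM2l //.
have -> : \sum_(1 <= n < X.+1) B n = 2 * q%:R *
    \sum_(i < M) \sum_(1 <= d < D.+1) d%:R^-1 * \sum_(h < d) G i (h%:R / d%:R).
  have DX : (D <= X)%N by exact: leq_div.
  rewrite (big_cat_nat (n := D.+1)) //= [X in _ + X]big_nat [X in _ + X]big1 ?addr0.
    rewrite exchange_big /= mulr_sumr; apply: eq_big_nat => d /andP[d0 dD].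
    rewrite /B -leq_divRL // -ltnS dD exchange_big -mulrA.
    by rewrite mulr_sumr mulr_sumr.
  by move=> n /andP[Dn _]; rewrite /B -leq_divRL // leqNgt Dn.
rewrite ler_wpM2l ?mulr_ge0 // mulr_sumr; apply: ler_sum => i _.
apply: le_trans (@lowest_terms (G i) D _) _; first by move=> x; exact: dprod_ge0.
rewrite ler_wpM2l //; first by apply: sumr_ge0 => e _; rewrite invr_ge0.
exact: farey_bound.
Qed.

End Farey.

Lemma log_le_powR (R : realType) (eta : R) : 0 < eta ->
  forall x, 1 <= x -> 1 + ln x <= (1 + eta^-1) * x `^ eta.
Proof.
move=> e0 x x1; have x0 : 0 < x by apply: lt_le_trans x1.
rewrite mulrDl mul1r lerD //.
  by rewrite -(powRr0 x) ler_powR // ltW.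
rewrite mulrC ler_pdivlMr // mulrC -ln_powR ltW // ln_sublinear //.
exact: powR_gt0.
Qed.

(** The divisor bound with exponent [k J] gives [tau ^ J <= c n]; a [J]-th root with [1 / J <= eta]
    suffices. *)
Lemma tau_le_powR (R : realType) k (eta : R) : 0 < eta ->
  exists2 C, 0 <= C & forall n, (0 < n)%N -> (tau k n)%:R <= C * n%:R `^ eta.
Proof.
move=> e0; pose J := (Num.truncn eta^-1).+1.
have J0 : 0 < J%:R :> R by rewrite ltr0n.
have JE : J%:R^-1 <= eta.
  by rewrite invf_ple ?posrE // ltW // /J truncnS_gt.
have [c Hc] := divisor_bound (k * J)%N.
exists (c%:R `^ J%:R^-1); first exact: powR_ge0.
move=> n n0.
have h : (tau k n)%:R ^+ J <= c%:R * n%:R :> R.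
  rewrite -natrX -natrM ler_nat; apply: leq_trans (Hc n n0).
  by rewrite expnM leq_exp2r // tau_le_divisors.
have n1 : 1 <= n%:R :> R by rewrite ler1n.
have -> : (tau k n)%:R = ((tau k n)%:R ^+ J) `^ J%:R^-1 :> R.
  by rewrite -powR_mulrn // -powRrM divff ?gt_eqF // powRr1.
apply: (@le_trans _ _ ((c%:R * n%:R) `^ J%:R^-1)).
  by apply: ge0_ler_powR; rewrite ?nnegrE ?invr_ge0 ?mulr_ge0 ?exprn_ge0 // ltW.
by rewrite powRM // ler_wpM2l ?powR_ge0 // ler_powR.
Qed.

(** * Exponents and conclusion *)

Section Exponents.
Variables (R : realType) (p q : nat).
Hypothesis p0 : (0 < p)%N.
Hypothesis q1 : (1 < q)%N.
Hypothesis th : theta q < 2^-1 :> R.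

Let q0 : (0 < q)%N. Proof. exact: ltnW. Qed.
Let qR : 0 < q%:R :> R. Proof. by rewrite ltr0n. Qed.
Let lq : 0 < ln q%:R :> R. Proof. by rewrite ln_gt0 // ltr1n. Qed.
Local Notation A := (6 * (1 + ln q%:R) : R).

Let A6 : 6 <= A. Proof. by have := lq; lra. Qed.

Lemma theta_gt0 : 0 < theta q :> R.
Proof. by rewrite divr_gt0 // ln_gt0 //; have := A6; lra. Qed.

(** From [theta q < 1 / 2] follows [ln q > 2 ln (6 (1 + ln q)) >= 2 ln 6 >= 5 / 3]. This is what
    yields [4 (2 + ln q) <= 6 (1 + ln q)]. *)
Lemma ln_ge1 : 1 <= ln q%:R :> R.
Proof.
have A0 : 0 < A by have := A6; lra.
have l6 : 5 / 6 <= ln 6 :> R.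
  have : ln (1 + - (5 / 6)) <= - (5 / 6) :> R by apply: le_ln1Dx; lra.
  rewrite (_ : 1 + - (5 / 6) = 6^-1); last by field.
  by rewrite lnV ?posrE // lerN2.
have : ln 6 <= ln A by rewrite ler_ln ?posrE.
move: th; rewrite /theta ltr_pdivrMr //; lra.
Qed.

Lemma powR_theta : q%:R `^ theta q = A.
Proof.
have A0 : 0 < A by have := A6; lra.
by rewrite /powR gt_eqF // /theta divfK ?gt_eqF // lnK.
Qed.

Lemma wsum_le_theta : wsum R q / q%:R <= q%:R `^ theta q.
Proof.
rewrite powR_theta ler_pdivrMr //; apply: le_trans (wsum_le R q0) _.
have := ln_ge1; move: (ln _) => l l1.
rewrite -mulrA mulrCA [leRHS]mulrC ler_pM2l //; lra.
Qed.

Lemma exists_rho : exists mu : R, [/\ 0 <= mu, mu < 1,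
  q%:R * (q%:R - gap R q p ^+ 2) <= (q%:R `^ mu) ^+ 2 &
  wsum R q ^+ 2 <= q%:R * (q%:R `^ mu) ^+ 2].
Proof.
(* [t] is the least admissible [rho ^ 2], and [rho = q ^ mu]. It stays below [q ^ 2]: the second
   entry since [gap > 0], the third since [w <= q ^ (1 + theta q)] with [theta q < 1 / 2]. *)
pose t := Num.max 1 (Num.max (q%:R * (q%:R - gap R q p ^+ 2)) (wsum R q ^+ 2 / q%:R)).
have q2 : 1 < q%:R :> R by rewrite ltr1n.
have w0 : 0 <= wsum R q by apply: sumr_ge0 => i _; exact: wt2_ge0.
have tq : t < q%:R ^+ 2.
  rewrite !gt_max; apply/and3P; split.
  - by rewrite exprn_egt1.
  - rewrite [ltRHS]expr2 ltr_pM2l // ltrBlDr ltrDl exprn_gt0 //.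
    by rewrite invr_gt0 mulr_gt0 ?ltr0n // addr_gt0.
  - have w1 : wsum R q <= q%:R * q%:R `^ theta q.
      by rewrite mulrC -ler_pdivrMr // wsum_le_theta.
    have a1 : (q%:R `^ theta q) ^+ 2 < q%:R :> R.
      rewrite -powR_mulrn ?powR_ge0 // -powRrM -[ltRHS]powRr1 ?ltW //.
      rewrite /powR gt_eqF // ltr_expR ltr_pM2r //.
      by move: th; lra.
    rewrite ltr_pdivrMr //; apply: (@le_lt_trans _ _ ((q%:R * q%:R `^ theta q) ^+ 2)).
      by rewrite ler_pXn2r ?nnegrE // mulr_ge0 ?powR_ge0.
    by rewrite exprMn ltr_pM2l // exprn_gt0.
have t1 : 1 <= t by rewrite le_max lexx.
have t0 : 0 < t by apply: lt_le_trans t1.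
exists (ln t / (2 * ln q%:R)).
have -> : (q%:R `^ (ln t / (2 * ln q%:R))) ^+ 2 = t.
  rewrite -powR_mulrn ?powR_ge0 // -powRrM /powR gt_eqF //.
  rewrite (_ : _ * ln q%:R = ln t) ?lnK //.
  by field; rewrite gt_eqF.
split.
- by rewrite divr_ge0 ?ln_ge0 // mulr_ge0 // ltW.
- rewrite ltr_pdivrMr ?mulr_gt0 // mul1r mulr_natl -lnXn // ltr_ln ?posrE //.
  by rewrite exprn_gt0.
- by rewrite !le_max lexx orbT.
- by rewrite mulrC -ler_pdivrMr // !le_max lexx !orbT.
Qed.

End Exponents.

Lemma char_sum_power (R : realType) (p q k : nat) : (1 < p)%N -> (1 < q)%N ->
  coprime (q - 1) p -> (2 <= k)%N -> theta q < k%:R^-1 :> R ->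
  exists lam C : R, [/\ 0 < lam, lam < 1, 0 <= C &
    forall b x, (0 < b < p)%N -> 1 <= x ->
    cabs (\sum_(1 <= n < (Num.truncn x).+1)
      digit_char q (b%:R / p%:R : R) n *+ tau k n) <= C * x `^ lam].
Proof.
move=> p1 q1 qp k2 thk.
have q0 : (0 < q)%N by exact: ltnW.
have qR : 0 < q%:R :> R by rewrite ltr0n.
have k0 : (0 < k)%N by exact: ltnW.
have kR : 0 < k%:R :> R by rewrite ltr0n.
have k2R : 2 <= k%:R :> R by rewrite ler_nat.
have kV : k%:R^-1 <= 2^-1 :> R by rewrite lef_pV2 ?posrE.
have th : theta q < 2^-1 :> R by exact: lt_le_trans thk kV.
have th0 := theta_gt0 R q1.
have [mu [mu0 mu1 rho2 w2]] := exists_rho (ltnW p1) q1 th.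
set rho := q%:R `^ mu in rho2 w2.
have rho1 : 1 <= rho by rewrite -(powRr0 q%:R) ler_powR // ler1n.
have rhoq : rho <= q%:R by rewrite -[leRHS](powRr1 (ltW qR)) ler_powR ?ler1n // ltW.
have rho0 : 0 < rho by exact: lt_le_trans rho1.
pose A := q%:R `^ (theta q : R).
have A1 : 1 <= A by rewrite -(powRr0 q%:R) ler_powR ?ler1n // ltW.
have wA : wsum R q / q%:R <= A by exact: wsum_le_theta.
have w0 : 0 <= wsum R q / q%:R.
  by rewrite divr_ge0 //; apply: sumr_ge0 => i _; exact: wt2_ge0.
(* With [P] about [x ^ sg], [sg = 1 / k - delta], the small factorisations cost [x ^ (1 - k delta)]
   and the cell term [x ^ (1 - sg + theta q) = x ^ (1 - delta)]: both save a power. *)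
pose delta := (k%:R^-1 - theta q) / 2 : R.
have d0 : 0 < delta by rewrite divr_gt0 // subr_gt0.
pose sg := k%:R^-1 - delta.
have sg0 : 0 < sg by rewrite /sg /delta; lra.
have sg1 : sg <= 1 by rewrite /sg; lra.
pose mx := Num.max (1 - delta) mu.
have mx1 : mx < 1 by rewrite gt_max mu1 andbT; lra.
have mxm : mu <= mx by rewrite le_max lexx orbT.
have mxd : 1 - delta <= mx by rewrite le_max lexx.
pose eta := (1 - mx) / 8.
have eta0 : 0 < eta by rewrite /eta; lra.
have [c2 c20 tauW] := tau_le_powR k eta0.
pose c1 := 1 + eta^-1.
have c10 : 0 <= c1 by rewrite addr_ge0 // invr_ge0 ltW.
pose c3 := 2 * q%:R ^+ 2 * A ^+ 2 + q%:R ^+ 2 * rho.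
have c30 : 0 <= c3.
  by rewrite addr_ge0 // !mulr_ge0 ?exprn_ge0 // ltW // (lt_le_trans _ A1).
(* Four factors [x ^ eta] are lost: to [tau], to the harmonic sum, to the number of digit levels and
   to the number of blocks of denominators. *)
pose lam := mx + eta *+ 4.
have lamE : lam = (1 + mx) / 2 by rewrite /lam /eta -mulr_natr; field.
exists lam, (1 + 4 * k%:R * c2 * q%:R * c1 ^+ 3 * c3).
split; try by rewrite lamE; lra.
  by rewrite addr_ge0 // !mulr_ge0 ?exprn_ge0.
move=> b x /andP[b0 bp] x1; have x0 : 0 < x by exact: lt_le_trans x1.
set X := Num.truncn x.
have X0 : (0 < X)%N by rewrite truncn_gt0.
have Xx : X%:R <= x by rewrite truncn_le ltW.
pose P := Num.truncn (x `^ sg).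
have xs1 : 1 <= x `^ sg by rewrite -(powRr0 x) ler_powR // ltW.
have P0 : (0 < P)%N by rewrite truncn_gt0.
have PX : (P <= X)%N.
  by apply: le_truncn; rewrite -[leRHS](powRr1 (ltW x0)) ler_powR.
pose N := trunc_log q X.
have /andP[N1 N2] := trunc_log_bounds q1 X0.
(* [X < q ^ (N + 1)] only gives [X + 1 <= q ^ (N + 1)], so one more digit is allowed for. *)
have XM : (X.+1 < q ^ N.+2)%N by apply: leq_ltn_trans N2 _; rewrite ltn_exp2l.
have qN : q%:R ^+ N <= x by apply: le_trans Xx; rewrite -natrX ler_nat.
pose W := c2 * x `^ eta.
have tW d : (0 < d <= X)%N -> (tau k d)%:R <= W.
  move=> /andP[dp dX]; apply: le_trans (tauW d dp) _; rewrite ler_wpM2l //.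
  apply: ge0_ler_powR; rewrite ?nnegrE ?(ltW eta0) ?(ltW x0) //.
  by apply: le_trans Xx; rewrite ler_nat.
have W0 : 0 <= W by rewrite mulr_ge0 ?powR_ge0.
apply: le_trans (char_sum_bound q1 b0 bp qp rho1 rhoq rho2 w2 P0 PX XM tW) _.
set D := (X %/ P)%N.
have D0 : (0 < D)%N by rewrite divn_gt0.
have DX : (D <= X)%N by exact: leq_div.
pose y := x `^ eta; pose z := x `^ mx; pose l := 1 + ln x.
have y0 : 0 <= y by exact: powR_ge0.
have z0 : 0 <= z by exact: powR_ge0.
have lx0 : 0 <= ln x by exact: ln_ge0.
have l0 : 0 <= l by rewrite addr_ge0.
have ly : l <= c1 * y by exact: log_le_powR.
have yz : x `^ lam = y ^+ 4 * z.
  rewrite /lam addrC powRD; last by apply/implyP => _; rewrite gt_eqF.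
  by rewrite -mulr_natr powRrM powR_mulrn // powR_ge0.
have Nl : N%:R + 1 <= l.
  rewrite /l addrC lerD2l; have lnq := ln_ge1 q1 th.
  apply: le_trans (_ : N%:R * ln q%:R <= _); first by rewrite ler_peMr.
  by rewrite mulr_natl -lnXn // ler_ln ?posrE // exprn_gt0.
have harm : \sum_(1 <= e < D.+1) (e%:R^-1 : R) <= l.
  apply: le_trans (harmonic_le R D0) _; rewrite lerD2l ler_ln ?posrE ?ltr0n //.
  by apply: le_trans Xx; rewrite ler_nat.
have harm0 : 0 <= \sum_(1 <= e < D.+1) (e%:R^-1 : R).
  by apply: sumr_ge0 => e _; rewrite invr_ge0.
have tl : (trunc_log q D).+1%:R <= l.
  apply: le_trans Nl; rewrite natr1 ler_nat ltnS.
  exact: leq_trunc_log.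
have powN (s : R) : 0 <= s -> (q%:R `^ s) ^+ N <= x `^ s.
  move=> s0; rewrite -powR_mulrn ?powR_ge0 // -powRrM mulrC powRrM powR_mulrn ?(ltW qR) //.
  by apply: ge0_ler_powR; rewrite ?nnegrE ?exprn_ge0 ?(ltW x0).
have powM (s : R) n : 0 <= s -> (n < N.+2)%N -> (q%:R `^ s) ^+ n <= (q%:R `^ s) ^+ 2 * x `^ s.
  move=> s0 nN; apply: (@le_trans _ _ ((q%:R `^ s) ^+ N.+2)).
    have qs1 : 1 <= q%:R `^ s by rewrite -[leLHS](powRr0 q%:R) ler_powR // ler1n.
    by rewrite ler_weXn2l 1?ltnW.
  by rewrite -[N.+2]add2n exprD ler_wpM2l ?exprn_ge0 ?powR_ge0 ?powN.
have Dle : D%:R <= 2 * x `^ (1 - sg).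
  have h1 : x `^ sg <= 2 * P%:R.
    apply: ltW; apply: lt_le_trans (truncnS_gt _) _; rewrite -/P -natr1 mulr_natl mulr2n.
    by rewrite lerD2l ler1n.
  have h2 : D%:R * P%:R <= x.
    by apply: le_trans Xx; rewrite -natrM ler_nat leq_divM.
  rewrite powRB; last by apply/implyP => _; rewrite gt_eqF.
  rewrite (powRr1 (ltW x0)) mulrA ler_pdivlMr ?powR_gt0 //.
  have := ler_wpM2l (ler0n R D) h1; lra.
have term n : (n < N.+2)%N -> q%:R ^+ 2 * D%:R * (wsum R q / q%:R) ^+ n +
    q%:R ^+ 2 / rho * rho ^+ n <= c3 * z.
  move=> nN; rewrite /c3 mulrDl; apply: lerD.
    have h1 : (wsum R q / q%:R) ^+ n <= A ^+ 2 * x `^ theta q.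
      by apply: le_trans (powM _ _ (ltW th0) nN); rewrite lerXn2r ?nnegrE // powR_ge0.
    have h2 : x `^ (1 - sg) * x `^ theta q <= z.
      rewrite -powRD; last by apply/implyP => _; rewrite gt_eqF.
      by rewrite ler_powR // (le_trans _ mxd) // /sg /delta; lra.
    apply: (@le_trans _ _ (q%:R ^+ 2 * (2 * x `^ (1 - sg)) * (A ^+ 2 * x `^ theta q))).
      by rewrite ler_pM ?mulr_ge0 ?exprn_ge0 // ler_wpM2l // exprn_ge0.
    rewrite (_ : _ * _ = 2 * q%:R ^+ 2 * A ^+ 2 * (x `^ (1 - sg) * x `^ theta q)).
      by rewrite ler_wpM2l // !mulr_ge0 ?exprn_ge0 // powR_ge0.
    by move: (x `^ _) (x `^ _) => u v; ring.
  have h1 : rho ^+ n <= rho ^+ 2 * z.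
    apply: le_trans (powM _ _ mu0 nN) _; rewrite ler_wpM2l ?exprn_ge0 ?powR_ge0 //.
    by rewrite ler_powR.
  rewrite -mulrA [_ * rho * _]mulrAC -mulrA [_ * rho]mulrC ler_wpM2l ?exprn_ge0 //.
  by rewrite ler_pdivrMl // mulrA -expr2.
have S : \sum_(n < N.+2) (trunc_log q D).+1%:R *
    (q%:R ^+ 2 * D%:R * (wsum R q / q%:R) ^+ n + q%:R ^+ 2 / rho * rho ^+ n) <=
    2 * l * (l * (c3 * z)).
  apply: (@le_trans _ _ (\sum_(n < N.+2) l * (c3 * z))).
    apply: ler_sum => n _; apply: ler_pM => //; last exact: term.
    by rewrite addr_ge0 ?mulr_ge0 ?exprn_ge0 ?invr_ge0 // ltW.
  rewrite sumr_const card_ord -[leLHS]mulr_natl ler_wpM2r ?mulr_ge0 //.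
  by rewrite -addn2 natrD; have : 1 <= l by [rewrite lerDl]; move: Nl; lra.
have S0 : 0 <= \sum_(n < N.+2) (trunc_log q D).+1%:R *
    (q%:R ^+ 2 * D%:R * (wsum R q / q%:R) ^+ n + q%:R ^+ 2 / rho * rho ^+ n).
  apply: sumr_ge0 => n _.
  by rewrite mulr_ge0 // addr_ge0 ?mulr_ge0 ?exprn_ge0 ?invr_ge0 // ltW.
rewrite [leRHS]mulrDl [X in _ <= X + _]mul1r; apply: lerD.
  apply: (@le_trans _ _ ((x `^ sg) ^+ k)).
    by rewrite lerXn2r ?nnegrE ?powR_ge0 // truncn_le powR_ge0.
  rewrite -powR_mulrn ?powR_ge0 // -powRrM ler_powR // /sg mulrBl mulVf ?gt_eqF //.
  have : delta * 2 <= delta * k%:R by rewrite ler_pM2l.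
  by rewrite lamE; lra.
rewrite yz; apply: (@le_trans _ _ (k%:R * (c2 * y * (2 * q%:R *
    (c1 * y * (2 * (c1 * y) * (c1 * y * (c3 * z)))))))).
  rewrite ler_wpM2l // ler_wpM2l // ler_wpM2l ?mulr_ge0 //.
  apply: ler_pM => //; first exact: le_trans ly.
  apply: le_trans S _; apply: ler_pM; rewrite ?mulr_ge0 //.
    by rewrite ler_pM2l.
  by rewrite ler_wpM2r // mulr_ge0.
rewrite le_eqVlt; apply/orP; left; apply/eqP; ring.
Qed.

(** * One exponent for all [k], and the passage to residue classes *)

Lemma uniform_exponent (R : realType) (Q : nat -> R -> Prop) :
  (forall k l l', Q k l -> l <= l' -> Q k l') ->
  (forall k, exists2 l, l < 1 & Q k l) ->
  forall K, exists2 l, 0 < l < 1 & forall k, (k < K)%N -> Q k l.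
Proof.
move=> mono ex; elim=> [|K [l /andP[l0 l1] IH]].
  by exists 2^-1 => //; apply/andP; split; lra.
have [l' l'1 QK] := ex K; exists (Num.max l l').
  by rewrite lt_max l0 gt_max l1.
move=> k; rewrite ltnS leq_eqVlt => /orP[/eqP ->|kK].
  by apply: mono QK _; rewrite le_max lexx orbT.
by apply: mono (IH _ kK) _; rewrite le_max lexx.
Qed.

(** The witness [p - (a mod p)] is a natural number, so the congruence becomes a divisibility that
    [cis_orthogonality] detects. *)
Lemma eqz_mod_dvdn (p : nat) (a : int) : (0 < p)%N -> exists a' : nat, forall n : nat,
  (n%:Z == a %[mod p%:Z])%Z = (p %| n + a')%N.
Proof.
move=> p0; have p0' : p%:Z != 0 by rewrite -lt0n.
have r0 := modz_ge0 a p0'; have rp := ltz_pmod a (p0 : 0 < p%:Z).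
exists `|p%:Z - (a %% p)%Z|%N => n; rewrite eqz_mod_dvd.
have -> : (p %| n + `|p%:Z - (a %% p)%Z|)%N =
    (p%:Z %| n%:Z + (p%:Z - (a %% p)%Z))%Z.
  have <- : `|p%:Z - (a %% p)%Z|%N%:Z = p%:Z - (a %% p)%Z.
    by rewrite gez0_abs // subr_ge0 ltW.
  by rewrite -PoszD dvdzE !absz_nat.
have -> : n%:Z + (p%:Z - (a %% p)%Z) = n%:Z - a + ((a %/ p)%Z + 1) * p%:Z.
  by rewrite {2}(divz_eq a p) mulrDl mul1r; ring.
by rewrite [RHS]rpredDr // dvdz_mull // dvdzz.
Qed.

Lemma cabs_real (R : realType) (r : R) : cabs (r%:C)%C = `|r|.
Proof. by rewrite /= expr0n /= addr0 sqrtr_sqr. Qed.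

Lemma equidistribution (R : realType) (k p q : nat) (a : int) (x C : R) : (0 < p)%N ->
  0 <= C ->
  (forall b, (0 < b < p)%N ->
    cabs (\sum_(1 <= n < (Num.truncn x).+1)
      digit_char q (b%:R / p%:R : R) n *+ tau k n) <= C) ->
  `|(sum_tau_digit k p q a x)%:R - p%:R^-1 * (sum_tau k x)%:R| <= C.
Proof.
move=> p0 C0 hC; have pR : 0 < p%:R :> R by rewrite ltr0n.
have [a' aE] := eqz_mod_dvdn a p0.
pose T b := \sum_(1 <= n < (Num.truncn x).+1)
      digit_char q (b%:R / p%:R : R) n *+ tau k n.
have E : p%:R * (sum_tau_digit k p q a x)%:R =
    \sum_(b < p) cis (b%:R / p%:R : R) ^+ a' * T b :> R[i].
  rewrite /sum_tau_digit natr_sum mulr_sumr big_mkcond /=.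
  under [RHS]eq_bigr do rewrite mulr_sumr.
  rewrite exchange_big /=; apply: eq_bigr => n _.
  transitivity ((\sum_(b < p) cis (b%:R / p%:R : R) ^+ (digit_sum q n + a')) *+ tau k n).
    rewrite cis_orthogonality // aE; case: ifP => _; last by rewrite mul0rn.
    by rewrite mulr_natr.
  rewrite -sumrMnl; apply: eq_bigr => b _.
  by rewrite exprD mulrnAr mulrC.
have E0 : T 0%N = (sum_tau k x)%:R.
  rewrite /T /sum_tau natr_sum; apply: eq_bigr => n _.
  by rewrite /digit_char mul0r cis0 expr1n.
rewrite -(ler_pM2l pR) -{1}(gtr0_norm pR) -normrM mulrBr mulrA divff ?gt_eqF // mul1r.
rewrite -cabs_real rmorphB rmorphM !rmorph_nat.
have {}hC b : (0 < b < p)%N -> cabs (T b) <= C by exact: hC.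
case: p p0 pR aE T hC E E0 => // p p0 pR aE T hC E E0.
(* The trivial character [b = 0] yields the main term and cancels; the others contribute at most [C]
   each. *)
rewrite E big_ord_recl /= mul0r cis0 expr1n mul1r -/(T 0%N) E0 addrAC subrr add0r.
apply: le_trans (cabs_sum _ _ _) _.
apply: (@le_trans _ _ (\sum_(i < p) C)).
  apply: ler_sum => i _; rewrite cabsM cabsX cabs_cis expr1n mul1r.
  by apply: hC; rewrite /bump /= add1n ltnS ltn_ord.
by rewrite sumr_const card_ord -[leLHS]mulr_natl ler_wpM2r // ler_nat.
Qed.

Theorem theorem1 (R : realType) (p q : nat) (hp : (1 < p)%N) (hq : (2 <= q)%N)
    (hpq : coprime (q - 1)%N p) :
  exists lambda : R, 0 < lambda < 1 /\
    forall (k : nat) (eps : R), (2 <= k)%N -> 0 < eps ->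
      theta q < (k%:R)^-1 :> R ->
      exists C1 C2 x0 : R, forall (a : int) (x : R), x0 <= x ->
        `| (sum_tau_digit k p q a x)%:R - (p%:R)^-1 * (sum_tau k x)%:R |
          <= C1 * (x `^ (1 - (k%:R)^-1 + theta q + eps))
             + C2 * (x `^ (lambda + eps)).
Proof.
(* The conditions on [k] are premises inside [Q], so that [Q] holds vacuously for the other [k] and
   [uniform_exponent] can range over all [k < K]. *)
pose Q k (l : R) := (2 <= k)%N -> theta q < k%:R^-1 :> R ->
  exists2 C : R, 0 <= C & forall b x, (0 < b < p)%N -> 1 <= x ->
    cabs (\sum_(1 <= n < (Num.truncn x).+1)
      digit_char q (b%:R / p%:R : R) n *+ tau k n) <= C * x `^ l.
have mono k l l' : Q k l -> l <= l' -> Q k l'.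
  move=> Ql ll' k2 thk; have [C C0 hC] := Ql k2 thk; exists C => // b x hb x1.
  by apply: le_trans (hC _ _ hb x1) _; rewrite ler_wpM2l // ler_powR.
have ex k : exists2 l, l < 1 & Q k l.
  have [/andP[k2 thk]|nk] := boolP ((2 <= k)%N && (theta q < k%:R^-1 :> R)).
    have [l [C [_ l1 C0 hC]]] := char_sum_power hp hq hpq k2 thk.
    by exists l => // _ _; exists C.
  by exists 0 => // k2 thk; move: nk; rewrite k2 thk.
(* Only the finitely many [k < 1 / theta q] matter, so one exponent serves all. *)
have [l l01 hl] := uniform_exponent mono ex (Num.truncn (theta q : R)^-1).+1.
have th0 := theta_gt0 R hq.
exists l; split=> // k eps k2 eps0 thk.
have k0 : (0 < k)%N by exact: ltnW.
have kR : 0 < k%:R :> R by rewrite ltr0n.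
have kK : (k < (Num.truncn (theta q : R)^-1).+1)%N.
  rewrite ltnS truncn_ge_nat ?invr_ge0 ?(ltW th0) // -[k%:R]invrK.
  by rewrite lef_pV2 ?posrE ?invr_gt0 // ltW.
have [C C0 hC] := hl k kK k2 thk.
(* The power saving [x ^ l] bounds the whole error, uniformly in [a]; from [x0 = 1] on, passing to
   [l + eps] only enlarges it. *)
exists 0, C, 1 => a x x1; rewrite mul0r add0r.
apply: (@le_trans _ _ (C * x `^ l)).
  apply: equidistribution; first exact: ltnW.
    by rewrite mulr_ge0 ?powR_ge0.
  by move=> b hb; exact: hC.
by rewrite ler_wpM2l // ler_powR // lerDl ltW.
Qed.
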